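(* The profile space $P$ (for a neutral full-ranking voting procedure) has the following decomposition into simple $\mathbb{Q}S_m\wr S_n$-submodules: $$P\;\cong\;\bigoplus_{\frac{(m^n)!}{(m!)^n\,n!}}\;\bigoplus_{\boldsymbol{\lambda}}\;\left(S^{\boldsymbol{\lambda}}\right)^{\oplus\dim(S^{\boldsymbol{\lambda}})},$$ where the outer sum denotes a direct sum of $\frac{(m^n)!}{(m!)^n\,n!}$ copies, and the inner sum $\bigoplus_{\boldsymbol{\lambda}}$ runs over a single copy of each simple $\mathbb{Q}S_m\wr S_n$-module $S^{\boldsymbol{\lambda}}$.
   Context: Let $m\ge 2$ and $n\ge 1$ be integers and $[n]=\{1,\dots,n\}$. There are $n$ departments, each with $m$ candidates; $i_k$ denotes candidate $k\in[m]$ from department $i\in[n]$. A committee is a tuple $(1_{k_1},2_{k_2},\ldots,n_{k_n})$ with $k_1,\ldots,k_n\in[m]$. A full ranking is a total ordering of all $m^n$ committees; there are $(m^n)!$ full rankings. The profile space $P$ is the $\mathbb{Q}$-vector space with basis the set of full rankings. The wreath product $S_m\wr S_n$ is the set of pairs $(\sigma;\pi)$ with $\sigma=(\sigma_1,\ldots,\sigma_n)\in S_m^n$, $\pi\in S_n$, with the group law for which $(\sigma;\pi)\, i_k=\pi(i)_{\sigma_{\pi(i)}(k)}$ defines a left action on candidates, i.e. $(\sigma;\pi)(\sigma';\pi')=(\tau;\pi\pi')$ with $\tau_i=\sigma_i\sigma'_{\pi^{-1}(i)}$. It acts on committees by $(\sigma;\pi)(1_{k_1},\ldots,n_{k_n})=(1_{\sigma_1(k_{\pi^{-1}(1)})},\ldots,n_{\sigma_n(k_{\pi^{-1}(n)})})$,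 hence on full rankings (by replacing each committee in the ranking by its image), which makes $P$ a $\mathbb{Q}S_m\wr S_n$-permutation module. The simple $\mathbb{Q}S_m\wr S_n$-modules are indexed as follows. Let $p(m)$ be the number of partitions of $m$, and fix an ordering $S^{\mu_1},\ldots,S^{\mu_{p(m)}}$ of the simple $\mathbb{Q}S_m$-modules (Specht modules). Let $\boldsymbol{\lambda}=(\lambda_1,\ldots,\lambda_{p(m)})$ be a vector of (possibly empty) partitions with $\sum_i|\lambda_i|=n$. Let $Y=S_{|\lambda_1|}\times\cdots\times S_{|\lambda_{p(m)}|}\le S_n$ be the corresponding Young subgroup. Let $D^\sim$ be the extension of the $S_m^n$-module $\bigotimes_i (S^{\mu_i})^{\otimes|\lambda_i|}$ to $S_m\wr Y=\{(\sigma;\pi):\pi\in Y\}$ via $(\sigma;\pi)(v_1\otimes\cdots\otimes v_n)=\sigma_1v_{\pi^{-1}(1)}\otimes\cdots\otimes\sigma_nv_{\pi^{-1}(n)}$, and let $D'$ be the $S_m\wr Y$-module on which $(\sigma;\pi)$ acts as $\pi$ acts on the simple $\mathbb{Q}Y$-module $\bigotimes_i S^{\lambda_i}$. Then $S^{\boldsymbol{\lambda}}$ is the module induced from $D^\sim\otimes D'$ from $S_m\wr Y$ to $S_m\wr S_n$. These $S^{\boldsymbol{\lambda}}$ form a complete set of representatives of the simple $\mathbb{Q}S_m\wr S_n$-modules. *)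

(* Defs.v *)
From HB Require Import structures.
From mathcomp Require Import all_boot all_order all_fingroup all_algebra.
From mathcomp Require Import all_solvable all_field all_character.

Set Implicit Arguments.
Unset Strict Implicit.
Unset Printing Implicit Defensive.

Import GroupScope GRing.Theory.
Local Open Scope ring_scope.

(** Side convention.  As everywhere in MathComp, permutations are composed from
    left to right, groups act on the right, and the vectors of a representation
    are row vectors.  Accordingly the product [x * y] of the wreath product
    below is the element usually written [y x] in the left-action convention,
    so that right modules here are exactly left modules there. *)

Section PermRepr.
Variables (gT : finGroupType) (X : finType) (to : {action gT &-> X}).

Definition basis_vec (x : X) : 'rV[rat]_#|X| := delta_mx 0 (enum_rank x).

Definition perm_repr_mx (g : gT) : 'M[rat]_#|X| :=
  \matrix_i basis_vec (to (enum_val i) g).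

Lemma basis_vec_act x g : basis_vec x *m perm_repr_mx g = basis_vec (to x g).
Proof. by rewrite -rowE rowK enum_rankK. Qed.

Lemma perm_repr_mxP : mx_repr [set: gT] perm_repr_mx.
Proof.
split=> [|g h _ _].
  by apply/row_matrixP=> i; rewrite rowK act1 row1 /basis_vec enum_valK.
apply/row_matrixP=> i; rewrite row_mul !rowK actM.
by rewrite basis_vec_act.
Qed.

Definition perm_repr : mx_representation rat [set: gT] #|X| :=
  MxRepresentation perm_repr_mxP.

End PermRepr.

(** A partition with at most [r] parts, each at most [r], padded with zeros;
    every partition of an integer at most [r] is of this form. *)
Definition part (r : nat) :=
  {p : {ffun 'I_r -> 'I_r.+1} |
     [forall i : 'I_r, forall j : 'I_r, (i <= j)%N ==> (p j <= p i)%N]}.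

Definition prow r (p : part r) (i : 'I_r) : nat := val p i.

Definition psize r (p : part r) : nat := (\sum_i prow p i)%N.

Definition intpart (m : nat) := {p : part m | psize p == m}.

Section Specht.
Variables (T : finType) (r : nat).

(** A tabloid is identified with the function sending each letter to its row.
    All shapes are allowed here: [tabloid_repr] is the direct sum of the
    permutation modules on the tabloids of all possible row lengths. *)
Definition tabloid := {ffun T -> 'I_r}.

Definition tabloid_act (R : tabloid) (s : {perm T}) : tabloid :=
  [ffun x => R (s^-1%g x)].

Lemma tabloid_act_is_action : is_action [set: {perm T}] tabloid_act.
Proof.
apply: is_total_action => [R|R s t].
  by apply/ffunP=> x; rewrite ffunE invg1 perm1.
by apply/ffunP=> x; rewrite !ffunE invMg permM.
Qed.

Canonical tabloid_action := Action tabloid_act_is_action.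

Definition tabloid_repr := perm_repr tabloid_action.

(** A tableau is given by the position (row, column) of each letter. *)
Definition tableau := {ffun T -> 'I_r * 'I_r}.

Definition tableau_of_shape (p : part r) (t : tableau) :=
  injectiveb t && ([set t x | x : T] == [set c : 'I_r * 'I_r | (c.2 < prow p c.1)%N]).

Definition tabloid_of (t : tableau) : tabloid := [ffun x => (t x).1].

Definition column_stab (t : tableau) : {set {perm T}} :=
  [set s : {perm T} | [forall x, (t (s x)).2 == (t x).2]].

Definition polytabloid (t : tableau) : 'rV[rat]_#|{: tabloid}| :=
  \sum_(s in column_stab t) (-1) ^+ s *: basis_vec (tabloid_act (tabloid_of t) s).

(** Only used when [psize p = #|T|]; otherwise there is no tableau of shape [p]. *)
Definition specht_mx (p : part r) : 'M[rat]_#|{: tabloid}| :=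
  (\sum_(t : tableau | tableau_of_shape p t) <<polytabloid t>>)%MS.

Definition tableau_act (t : tableau) (s : {perm T}) : tableau :=
  [ffun x => t (s^-1%g x)].

Lemma tableau_act_shape p t s :
  tableau_of_shape p t -> tableau_of_shape p (tableau_act t s).
Proof.
rewrite /tableau_of_shape => /andP[/injectiveP injt /eqP <-]; apply/andP; split.
  by apply/injectiveP=> x y; rewrite !ffunE => /injt/perm_inj.
apply/eqP/setP=> c; apply/imsetP/imsetP=> [] [x _ ->].
  by exists (s^-1%g x); rewrite ?ffunE.
by exists (s x); rewrite ?ffunE ?permK.
Qed.

Lemma polytabloid_act t s :
  polytabloid t *m tabloid_repr s = polytabloid (tableau_act t s).
Proof.
rewrite /polytabloid mulmx_suml [RHS](reindex_inj (conjg_inj s)) /=.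
apply: eq_big => [u|u _].
  rewrite !inE; apply/forallP/forallP=> h x; last first.
    by have:= h (s x); rewrite !ffunE conjgE !permM !permK.
  by rewrite !ffunE conjgE !permM permK; apply: h.
rewrite -scalemxAl basis_vec_act odd_permJ; congr (_ *: basis_vec _).
apply/ffunP=> x; rewrite !ffunE -conjVg conjgE !permM permK.
by [].
Qed.

Lemma specht_mxmodule p : mxmodule tabloid_repr (specht_mx p).
Proof.
apply/mxmoduleP=> s _; rewrite /specht_mx sumsmxMr.
apply/sumsmx_subP=> t ht; rewrite (eqmxMr _ (genmxE _)) polytabloid_act.
apply: (sumsmx_sup (tableau_act t s)); first exact: tableau_act_shape.
by rewrite genmxE.
Qed.

Definition specht_repr (p : part r) := submod_repr (specht_mxmodule p).

End Specht.

Section Wreath.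
Variables m n : nat.

Record wreath := Wreath { wr_sigma : {ffun 'I_n -> 'S_m}; wr_pi : 'S_n }.

Definition wreath_pair w := (wr_sigma w, wr_pi w).
Definition pair_wreath p := Wreath p.1 p.2.
Lemma wreath_pairK : cancel wreath_pair pair_wreath. Proof. by case. Qed.

HB.instance Definition _ := Finite.copy wreath (can_type wreath_pairK).

Definition wr_one := Wreath [ffun=> 1%g] 1%g.
Definition wr_inv w :=
  Wreath [ffun i => (wr_sigma w (wr_pi w i))^-1%g] (wr_pi w)^-1%g.
(** In the left-action convention this is [w v], namely
    [(sigma; pi) (sigma'; pi') = (tau; pi o pi')] with
    [tau_i = sigma_i o sigma'_{pi^-1 i}], [w = (sigma; pi)], [v = (sigma'; pi')]. *)
Definition wr_mul v w :=
  Wreath [ffun i => (wr_sigma v ((wr_pi w)^-1 i) * wr_sigma w i)%g]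
         (wr_pi v * wr_pi w)%g.

Lemma wreathP v w : wr_sigma v =1 wr_sigma w -> wr_pi v = wr_pi w -> v = w.
Proof. by case: v w => [s p] [s' p'] /= /ffunP-> ->. Qed.

Lemma wr_mulA : associative wr_mul.
Proof.
by move=> u v w; apply: wreathP => [i|]; rewrite /= ?mulgA //= !ffunE mulgA invMg permM.
Qed.

Lemma wr_mul1 : left_id wr_one wr_mul.
Proof. by move=> w; apply: wreathP => [i|]; rewrite /= ?mul1g // !ffunE mul1g. Qed.

Lemma wr_mulV : left_inverse wr_one wr_inv wr_mul.
Proof.
by move=> w; apply: wreathP => [i|]; rewrite /= ?mulVg // !ffunE permKV mulVg.
Qed.

HB.instance Definition _ := Finite_isGroup.Build wreath wr_mulA wr_mul1 wr_mulV.

Lemma wr_pi_morph : {in [set: wreath] &, {morph wr_pi : v w / (v * w)%g}}.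
Proof. by []. Qed.
Canonical wr_pi_morphism := Morphism wr_pi_morph.

(** [(sigma; pi)] maps the family [(R_i)_i] to
    [(sigma_i R_{pi^-1 i})_i]. *)
Section Families.
Variables (X : finType) (to : {action 'S_m &-> X}).

Definition wr_act (R : {ffun 'I_n -> X}) (w : wreath) : {ffun 'I_n -> X} :=
  [ffun i => to (R ((wr_pi w)^-1%g i)) (wr_sigma w i)].

Lemma wr_act_is_action : is_action [set: wreath] wr_act.
Proof.
apply: is_total_action => [R|R v w]; apply/ffunP=> i; rewrite !ffunE /=.
  by rewrite invg1 perm1 act1.
  by rewrite actM invMg permM.
Qed.

Definition wr_action := Action wr_act_is_action.

End Families.

Definition committee := {ffun 'I_n -> 'I_m}.

Definition committee_action : {action wreath &-> committee} :=
  wr_action (perm_action 'I_m).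

(** There are [m ^ n] committees, so each occurs exactly once in a ranking. *)
Definition ranking := {t : (m ^ n).-tuple committee | uniq t}.

Lemma ranking_act_subproof (t : ranking) (w : wreath) :
  uniq (map_tuple (committee_action^~ w) (val t)).
Proof. by rewrite map_inj_uniq ?(valP t) //; apply: act_inj. Qed.

Definition ranking_act (t : ranking) (w : wreath) : ranking :=
  exist (fun t : (m ^ n).-tuple committee => uniq t) _ (ranking_act_subproof t w).

Lemma ranking_act_is_action : is_action [set: wreath] ranking_act.
Proof.
apply: is_total_action => [t|t v w]; apply/val_inj/val_inj => /=.
  by rewrite (eq_map (act1 committee_action)) map_id.
by rewrite -map_comp; apply: eq_map => k; exact: (actM committee_action).
Qed.

Definition ranking_action := Action ranking_act_is_action.

Definition profile_repr := perm_repr ranking_action.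

End Wreath.

Section Tensor.
Variables m n : nat.
Variables (X : finType) (to : {action 'S_m &-> X}).

Local Notation N := #|X|.

(** [tens v] is [v_1 (x) ... (x) v_n], in the basis of families of elements
    of [X]. *)
Definition tens (v : 'I_n -> 'rV[rat]_N) : 'rV[rat]_#|{: {ffun 'I_n -> X}}| :=
  \row_j \prod_i v i 0 (enum_rank ((enum_val j : {ffun 'I_n -> X}) i)).

(** The tensor product of the row spaces of the [V i]. *)
Definition tensor_mx (V : 'I_n -> 'M[rat]_N) : 'M[rat]_#|{: {ffun 'I_n -> X}}| :=
  (\sum_(a : {ffun 'I_n -> 'I_N}) <<tens (fun i => row (a i) (V i))>>)%MS.

Lemma tensE (v : 'I_n -> 'rV[rat]_N) :
  tens v = \sum_(f : {ffun 'I_n -> X})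
              (\prod_i v i 0 (enum_rank (f i))) *: basis_vec f.
Proof.
apply/rowP=> j; rewrite mxE summxE (bigD1 (enum_val j)) //=.
rewrite [X in _ + X]big1 ?addr0 => [|f nf].
  by rewrite !mxE enum_valK !eqxx mulr1.
rewrite !mxE /=; case: eqP => [ej|]; last by rewrite mulr0.
by case/eqP: nf; rewrite ej enum_rankK.
Qed.

Lemma tens_sub (V : 'I_n -> 'M[rat]_N) (v : 'I_n -> 'rV[rat]_N) :
  (forall i, (v i <= V i)%MS) -> (tens v <= tensor_mx V)%MS.
Proof.
move=> vV; have /fin_all_exists[c hc]: forall i, exists c, v i = c *m V i.
  by move=> i; exact/submxP.
have -> : tens v = \sum_(a : {ffun 'I_n -> 'I_N})
    (\prod_i c i 0 (a i)) *: tens (fun i => row (a i) (V i)).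
  apply/rowP=> j; rewrite mxE summxE.
  transitivity (\prod_i \sum_k c i 0 k * V i k (enum_rank ((enum_val j : {ffun 'I_n -> X}) i))).
    by apply: eq_bigr => i _; rewrite {1}hc mxE.
  rewrite bigA_distr_bigA /=; apply: eq_bigr => a _.
  rewrite !mxE big_split; congr (_ * _).
  by apply: eq_bigr => i _; rewrite mxE.
apply: summx_sub => a _; apply: scalemx_sub.
by apply: (sumsmx_sup a); rewrite ?genmxE.
Qed.

Lemma perm_reprE (v : 'rV[rat]_N) (s : 'S_m) x :
  (v *m perm_repr to s) 0 (enum_rank x) = v 0 (enum_rank (to x s^-1%g)).
Proof.
rewrite mxE (bigD1 (enum_rank (to x s^-1%g))) //= big1 ?addr0 => [|k nk].
  by rewrite !mxE enum_rankK actKV !eqxx mulr1.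
rewrite !mxE /=; case: eqP => [ek|]; last by rewrite mulr0.
case/eqP: nk; move/enum_rank_inj: ek => ->.
by rewrite actK enum_valK.
Qed.

Lemma tens_act (v : 'I_n -> 'rV[rat]_N) (w : wreath m n) :
  tens v *m perm_repr (wr_action n to) w =
  tens (fun i => v ((wr_pi w)^-1%g i) *m perm_repr to (wr_sigma w i)).
Proof.
rewrite !tensE mulmx_suml.
rewrite [RHS](reindex_inj (act_inj (wr_action n to) w)) /=.
apply: eq_bigr => f _; rewrite -scalemxAl basis_vec_act; congr (_ *: _).
rewrite (reindex_inj (@perm_inj _ (wr_pi w)^-1%g)).
by apply: eq_bigr => i _; rewrite perm_reprE ffunE actKin ?inE.
Qed.

End Tensor.

Section Induced.
Variables (gT : finGroupType) (H G : {group gT}) (d : nat).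
Variable rH : mx_representation rat H d.

Definition ext_mx (x : gT) : 'M[rat]_d := if x \in H then rH x else 0.

Definition coset_rep (i : 'I_#|rcosets H G|) : gT := repr (enum_val i).

(** The matrices of the induced representation in the basis
    [v_b (x) coset_rep i]. *)
Definition induced_mx (x : gT) : 'M[rat]_(\sum_(i < #|rcosets H G|) d) :=
  \mxblock_(i, j) ext_mx (coset_rep i * x * (coset_rep j)^-1)%g.

Lemma coset_rep_in i : H \subset G -> coset_rep i \in G.
Proof.
move=> sHG; have /rcosetsP[x Gx e] := enum_valP i; rewrite /coset_rep e.
by case: repr_rcosetP => h Hh; rewrite groupM // (subsetP sHG).
Qed.

Lemma mem_coset_rep i z :
  (z * (coset_rep i)^-1 \in H)%g = (enum_val i == H :* z).
Proof.
have /rcosetsP[x Gx e] := enum_valP i; rewrite -mem_rcoset /coset_rep e.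
by rewrite rcoset_repr eq_sym; apply/rcoset_eqP/eqP.
Qed.

Lemma induced_mx_repr : H \subset G -> mx_repr G induced_mx.
Proof.
move=> sHG; split=> [|x y Gx Gy].
  rewrite -mxdiagZ; apply/eq_mxblock => i j; rewrite mulg1 /ext_mx mem_coset_rep.
  have [<-|nij] := eqVneq i j; last first.
    rewrite ifN //; apply: contra nij => /eqP e; apply/eqP/enum_val_inj.
    rewrite e; have /rcosetsP[z _ ez] := enum_valP i.
    by rewrite /coset_rep ez rcoset_repr.
  rewrite conform_mx_id mulgV repr_mx1 ifT //.
  by rewrite -mem_coset_rep mulgV.
rewrite /induced_mx mul_mxblock; apply/eq_mxblock => i j.
have Gi := coset_rep_in i sHG.
have GxI : (H :* (coset_rep i * x))%g \in rcosets H G.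
  by apply/rcosetsP; exists (coset_rep i * x)%g; rewrite ?groupM.
pose k := enum_rank_in GxI (H :* (coset_rep i * x))%g.
have ek : enum_val k = (H :* (coset_rep i * x))%g by rewrite enum_rankK_in.
have Hk : (coset_rep i * x * (coset_rep k)^-1 \in H)%g.
  by rewrite mem_coset_rep ek.
rewrite (bigD1 k) //= [X in _ + X]big1 ?addr0 => [|l nl]; last first.
  rewrite /ext_mx ifN ?mul0mx //; apply: contra nl; rewrite mem_coset_rep -ek.
  by move/eqP/enum_val_inj->.
have e : (coset_rep i * (x * y) * (coset_rep j)^-1 =
    (coset_rep i * x * (coset_rep k)^-1) * (coset_rep k * y * (coset_rep j)^-1))%g.
  by rewrite !mulgA mulgKV.
rewrite /ext_mx Hk e groupMl //; case: ifP => Hj; last by rewrite mulmx0.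
by rewrite repr_mxM.
Qed.

Definition induced_repr (sHG : H \subset G) :=
  MxRepresentation (induced_mx_repr sHG).

End Induced.

Section Products.
Variables (gT : finGroupType) (G : {group gT}).

Lemma triv_mx_repr : mx_repr G (fun _ : gT => 1%:M : 'M[rat]_1).
Proof. by split=> // x y _ _; rewrite mulmx1. Qed.

Definition triv_grepr : representation rat G :=
  Representation (MxRepresentation triv_mx_repr).

Definition prod_grepr (rG1 rG2 : representation rat G) : representation rat G :=
  Representation (prod_repr rG1 rG2).

End Products.

Section WreathSpecht.
Variables (m n : nat).

Definition nparts := #|{: intpart m}|.

Definition multipart :=
  {l : {ffun 'I_nparts -> part n} | (\sum_k psize (l k))%N == n}.

Section Fixed.
Variable mu : 'I_nparts -> intpart m.
Variable l : multipart.

(** The index of the block containing each [i]: the first [psize (l 0)] points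
    are in block 0, the next [psize (l 1)] in block 1, and so on. *)
Definition block_word : seq 'I_nparts :=
  flatten [seq nseq (psize (val l k)) k | k <- enum 'I_nparts].

Lemma size_block_word : size block_word == n.
Proof.
rewrite size_flatten /shape -map_comp sumnE big_map big_enum /=.
by under eq_bigr do rewrite size_nseq; apply: (valP l).
Qed.

Definition block (i : 'I_n) : 'I_nparts := tnth (Tuple size_block_word) i.

Definition young : {group 'S_n} :=
  (\bigcap_k 'N([set i | block i == k] | 'P))%G.

Lemma young_block s i : s \in young -> block (s i) = block i.
Proof.
move=> /bigcapP/(_ (block i) isT)/(astabs_act i).
by rewrite !inE eqxx /= => /eqP.
Qed.

Definition wr_young : {group wreath m n} := (wr_pi_morphism m n @*^-1 young)%G.

Definition Dtilde_mx :=
  tensor_mx (fun i => specht_mx 'I_m (val (mu (block i)))).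

Lemma wr_young_block w i : w \in wr_young -> block ((wr_pi w)^-1%g i) = block i.
Proof.
case/morphpreP=> _ /= /groupVr; exact: young_block.
Qed.

Lemma Dtilde_mxmodule :
  mxmodule (subg_repr (perm_repr (wr_action n (tabloid_action 'I_m m)))
                      (subsetT wr_young))
           Dtilde_mx.
Proof.
apply/mxmoduleP=> w Hw; rewrite /Dtilde_mx {1}/tensor_mx sumsmxMr.
apply/sumsmx_subP=> a _; rewrite (eqmxMr _ (genmxE _)) tens_act.
apply: tens_sub => i /=; rewrite (wr_young_block i Hw).
apply: submx_trans (mxmoduleP (specht_mxmodule _ _) _ (in_setT _)).
exact: submxMr (row_sub _ _).
Qed.

Definition Dtilde_repr := submod_repr Dtilde_mxmodule.

Definition block_type (k : 'I_nparts) := {i : 'I_n | block i == k}.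

Definition block_perm (k : 'I_nparts) :=
  actperm_morphism (subaction (block_type k) 'P).

Lemma young_block_perm k :
  young \subset block_perm k @*^-1 [set: {perm block_type k}].
Proof.
apply/subsetP=> s Ys; rewrite !inE andbT.
apply/subsetP=> i; rewrite !inE => /eqP <-.
by rewrite /= /aperm young_block.
Qed.

Definition young_factor (k : 'I_nparts) : mx_representation rat young _ :=
  subg_repr (morphpre_repr (block_perm k) (specht_repr (block_type k) (val l k)))
            (young_block_perm k).

(** The simple module of [young] that is the tensor product of the Specht
    modules of the partitions [val l k]. *)
Definition young_specht : representation rat young :=
  \big[@prod_grepr _ _/triv_grepr young]_k Representation (young_factor k).

Definition Dprime_repr : mx_representation rat wr_young _ :=
  morphpre_repr (wr_pi_morphism m n) young_specht.

Definition wreath_specht : representation rat [set: wreath m n] :=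
  Representation (induced_repr (prod_repr Dtilde_repr Dprime_repr)
                               (subsetT wr_young)).

End Fixed.
End WreathSpecht.

(* Main.v *)
(** The argument is a multiplicity count. If finitely many nonzero rational
    representations [V l] of a group [G] satisfy
    [sum_l dim (V l) * chi_(V l) = regular character], then comparing the
    multiplicity of an irreducible constituent of some [V l] on both sides
    forces the [V l] to be irreducible, pairwise non-isomorphic and exhaustive;
    no Clifford or Mackey theory is needed. For the symmetric groups this
    identity comes from James' argument with polytabloids (the Specht modules
    have only scalar intertwiners and are pairwise non-isomorphic) together with
    the bound "number of classes <= number of partitions". For the wreath product
    it is a character computation: summing over the partition vectors of a fixed
    block pattern first collapses the Young subgroup factor to a regular
    character, and the sum over all patterns [f : [n] -> irreducibles of S_m]
    then factors as a product of regular characters of [S_m]. Finally the wreath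
    product acts freely on the rankings, so that the profile module has a multiple
    of the regular character, and over the rationals equal characters mean
    isomorphic modules. *)
Require Import Defs.
From mathcomp Require Import all_boot all_order all_fingroup all_algebra.
From mathcomp Require Import all_solvable all_field all_character.
From mathcomp Require Import ring.

Set Implicit Arguments.
Unset Strict Implicit.
Unset Printing Implicit Defensive.

Import Order.TTheory GroupScope GRing.Theory Num.Theory.
Local Open Scope ring_scope.

(** * Rational characters *)

Section RationalRepresentations.
Variables (gT : finGroupType) (G : {group gT}).
Local Notation reprQ := (mx_representation rat G).

Definition intertwines d1 d2 (r1 : reprQ d1) (r2 : reprQ d2) (A : 'M_(d1, d2)) :=
  forall x, x \in G -> r1 x *m A = A *m r2 x.

(** The sum is not divided by [#|G|]; the factor reappears as [#|G|%:R^-1] in [cfdot_qchar]. *)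
Definition average d1 d2 (r1 : reprQ d1) (r2 : reprQ d2) (A : 'M_(d1, d2)) :=
  \sum_(x in G) r1 x^-1%g *m A *m r2 x.

Lemma average_intertwines d1 d2 (r1 : reprQ d1) (r2 : reprQ d2) A :
  intertwines r1 r2 (average r1 r2 A).
Proof.
move=> x Gx; rewrite /average mulmx_sumr mulmx_suml.
rewrite [RHS](reindex_acts 'R _ (groupVr Gx)) ?astabsR //=.
apply: eq_bigr => y Gy; rewrite invMg invgK !repr_mxM ?groupV //.
by rewrite -!mulmxA -[r2 x^-1%g *m r2 x]repr_mxM ?groupV // mulVg repr_mx1 mulmx1.
Qed.

(** The [(i, j)] entry of [r1 x^-1 *m delta_mx i j *m r2 x] is the product of the [i]-th diagonal
    entry of [r1 x^-1] and the [j]-th one of [r2 x]. *)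
Lemma average_trace d1 d2 (r1 : reprQ d1) (r2 : reprQ d2) :
  \sum_(x in G) \tr (r1 x^-1%g) * \tr (r2 x)
    = \sum_i \sum_j average r1 r2 (delta_mx i j) i j.
Proof.
under eq_bigr do rewrite /mxtrace big_distrlr /=.
rewrite exchange_big; apply: eq_bigr => i _ /=.
rewrite exchange_big; apply: eq_bigr => j _ /=.
rewrite summxE; apply: eq_bigr => x _ /=.
rewrite mxE (bigD1 j) //= big1 => [|k nkj]; last first.
  rewrite mxE big1 ?mul0r // => l _.
  by rewrite !mxE (negPf nkj) andbF mulr0.
rewrite addr0 mxE (bigD1 i) //= big1 => [|k nki]; last by rewrite !mxE (negPf nki) mulr0.
by rewrite !mxE !eqxx mulr1 addr0.
Qed.

Definition qchar d (r : reprQ d) : 'CF(G) := cfRepr (map_repr (@ratr algC) r).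

Lemma qcharE d (r : reprQ d) x : x \in G -> qchar r x = ratr (\tr (r x)).
Proof. by move=> Gx; rewrite cfunE Gx -trace_map_mx. Qed.

Lemma qchar1 d (r : reprQ d) : qchar r 1%g = d%:R.
Proof. exact: cfRepr1. Qed.

Lemma qchar_char d (r : reprQ d) : qchar r \is a character.
Proof. exact: cfRepr_char. Qed.

(** A character takes conjugate values at [x] and [x^-1], and rational values are their own
    conjugates. *)
Lemma trace_inv d (r : reprQ d) x : x \in G -> \tr (r x^-1%g) = \tr (r x).
Proof.
move=> Gx; have /= := char_inv x (qchar_char r); rewrite !qcharE ?groupV //.
by rewrite conj_Crat ?Crat_rat // => /fmorph_inj ->.
Qed.

Lemma cfdot_qchar d1 d2 (r1 : reprQ d1) (r2 : reprQ d2) :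
  '[qchar r1, qchar r2] =
     ratr (#|G|%:R^-1 * \sum_(x in G) \tr (r1 x^-1%g) * \tr (r2 x)).
Proof.
rewrite cfdotE rmorphM fmorphV rmorph_nat rmorph_sum; congr (_ * _).
apply: eq_bigr => x Gx; rewrite rmorphM trace_inv // !qcharE //.
by rewrite conj_Crat ?Crat_rat // mulrC.
Qed.

(* Schur's lemma in the form needed when all self-intertwiners are scalar:
   averaging [delta_mx i j] then gives [(i == j) * #|G| / d]. *)
Lemma qchar_norm1 d (r : reprQ d) :
    (0 < d)%N -> (forall A, intertwines r r A -> is_scalar_mx A) ->
  '[qchar r] = 1.
Proof.
move=> d_gt0 scal; rewrite cfdot_qchar average_trace.
have nzd : d%:R != 0 :> rat by rewrite pnatr_eq0 -lt0n.
have avgE i j : average r r (delta_mx i j) i j = (i == j)%:R * (#|G|%:R / d%:R).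
  have /is_scalar_mxP[c avgc] := scal _ (average_intertwines r r (delta_mx i j)).
  have: \tr (average r r (delta_mx i j)) = (i == j)%:R * #|G|%:R.
    rewrite /average raddf_sum /= (eq_bigr (fun=> (i == j)%:R)) => [|x Gx].
      by rewrite sumr_const mulr_natr.
    rewrite mxtrace_mulC mulmxA -repr_mxM ?groupV // mulgV repr_mx1 mul1mx.
    rewrite /mxtrace (bigD1 i) //= big1 ?addr0 => [|k nk].
      by rewrite mxE eqxx.
    by rewrite mxE (negPf nk).
  rewrite avgc mxtrace_scalar mxE -[c *+ d]mulr_natr => cd.
  have -> : c = (i == j)%:R * (#|G|%:R / d%:R) by rewrite mulrA -cd mulfK.
  by case: eqP; rewrite ?mulr1n ?mulr0n // mul0r.
rewrite (eq_bigr (fun=> #|G|%:R / d%:R)) => [|i _].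
  rewrite sumr_const card_ord -[_ *+ d]mulr_natr divfK //.
  by rewrite mulVf ?rmorph1 // pnatr_eq0 -lt0n cardG_gt0.
rewrite (bigD1 i) //= big1 => [|j nj]; rewrite avgE; last first.
  by rewrite eq_sym (negPf nj) mul0r.
by rewrite eqxx mul1r addr0.
Qed.

(** If the averages of all elementary matrices vanished, [average_trace] would make the inner
    product zero. *)
Lemma qchar_dot_hom d1 d2 (r1 : reprQ d1) (r2 : reprQ d2) :
  '[qchar r1, qchar r2] != 0 -> exists2 A, intertwines r1 r2 A & A != 0.
Proof.
rewrite cfdot_qchar average_trace => nz.
case: (pickP (fun ij => average r1 r2 (delta_mx ij.1 ij.2) != 0)) => [ij nzij | z].
  by exists (average r1 r2 (delta_mx ij.1 ij.2)) => //; exact: average_intertwines.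
case/eqP: nz; rewrite big1 ?mulr0 ?rmorph0 // => i _; rewrite big1 // => j _.
by have /negbFE/eqP -> := z (i, j); rewrite mxE.
Qed.

Lemma intertwines_rsim d1 d2 (r1 : reprQ d1) (r2 : reprQ d2) A :
    mx_irreducible r1 -> mx_irreducible r2 -> intertwines r1 r2 A -> A != 0 ->
  mx_rsim r1 r2.
Proof.
move=> /mx_irrP[_ irr1] /mx_irrP[_ irr2] homA nzA.
have ker0 : kermx A = 0.
  apply/eqP; apply/idPn => nzK; have kerm: mxmodule r1 (kermx A).
    apply/mxmoduleP=> x Gx; apply/sub_kermxP.
    by rewrite -mulmxA homA // mulmxA mulmx_ker mul0mx.
  have full := irr1 _ kerm nzK; case/negP: nzA.
  have /row_fullP[B BK] := full.
  by rewrite -[A]mul1mx -BK -mulmxA mulmx_ker mulmx0.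
have freeA : row_free A by rewrite -kermx_eq0 ker0.
have fullA : row_full A.
  rewrite -(eq_row_full (genmxE A)).
  apply: irr2; last by rewrite -submx0 genmxE submx0.
  apply/mxmoduleP=> x Gx; rewrite (eqmxMr _ (genmxE A)) genmxE -homA //.
  exact: submxMl.
by exists A => //; rewrite -(eqP freeA) (eqP fullA).
Qed.

Lemma mxtrace_dadd (r1 r2 : representation rat G) x :
  \tr (dadd_grepr r1 r2 x) = \tr (r1 x) + \tr (r2 x).
Proof. exact: mxtrace_block. Qed.

Lemma mxtrace_bigdadd (I : finType) (r : I -> representation rat G) x :
  \tr ((\big[dadd_grepr/grepr0]_i r i) x) = \sum_i \tr (r i x).
Proof.
apply: (big_morph (fun r0 : representation rat G => \tr (r0 x))) => [r1 r2|].
  exact: mxtrace_dadd.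
exact: mxtrace1.
Qed.

Lemma ratG_completely_reducible d (r : reprQ d) : mx_completely_reducible r 1%:M.
Proof.
apply: mx_Maschke_pchar; rewrite /pgroup pcharf'_nat pnatr_eq0 -lt0n.
exact: cardG_gt0.
Qed.

(** Induction on the dimension. Equal characters give a nonzero intertwiner [A]. By Maschke, [r1] is
    the kernel of [A] plus a complement [W], and [r2] is the image of [A] plus a complement [C]. [W]
    is isomorphic to the image, so the kernel and [C] have equal traces, and the kernel is smaller
    than [r1]. *)
Lemma eq_trace_rsim d1 d2 (r1 : reprQ d1) (r2 : reprQ d2) :
  (forall x, x \in G -> \tr (r1 x) = \tr (r2 x)) -> mx_rsim r1 r2.
Proof.
have [n] := ubnP d1; elim: n => // n IHn in d1 d2 r1 r2 *; rewrite ltnS => le_d1n eq12.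
have eqd : d1 = d2.
  have := eq12 1%g (group1 G); rewrite !repr_mx1 !mxtrace1 => /eqP.
  by rewrite eqr_nat => /eqP.
case: (posnP d1) => [d10|d1_gt0].
  exists 0 => // [|x _]; last by rewrite mulmx0 mul0mx.
  by rewrite /row_free mxrank0 d10.
have eqchar : qchar r1 = qchar r2.
  by apply/cfun_inP=> x Gx; rewrite !qcharE ?eq12.
have [|A homA nzA] := @qchar_dot_hom _ _ r1 r2.
  rewrite -eqchar cfnorm_eq0 -char1_eq0 ?qchar_char // qchar1 pnatr_eq0.
  by rewrite -lt0n.
have modK : mxmodule r1 (kermx A).
  apply/mxmoduleP=> x Gx; apply/sub_kermxP.
  by rewrite -mulmxA homA // mulmxA mulmx_ker mul0mx.
have modI : mxmodule r2 <<A>>%MS.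
  apply/mxmoduleP=> x Gx; rewrite (eqmxMr _ (genmxE A)) genmxE -homA //.
  exact: submxMl.
have [W modW defW dxW] := ratG_completely_reducible modK (submx1 _).
have [C modC defC dxC] := ratG_completely_reducible modI (submx1 _).
have freeWA : \rank (W *m A) = \rank W.
  by apply/mxrank_injP; rewrite capmxC; apply/eqP/mxdirect_addsP.
have eqWA : (W *m A :=: <<A>>)%MS.
  apply/eqmxP; rewrite genmxE submxMl /= genmxE.
  rewrite -[A in (A <= _)%MS]mul1mx -(eqmxMr _ defW) addsmxMr mulmx_ker.
  by rewrite addsmx_sub sub0mx submx_refl.
have rWI : mx_rsim (submod_repr modW) (submod_repr modI).
  exists (in_submod <<A>>%MS (val_submod 1%:M *m A)) => [||x Gx].
  - by rewrite -eqWA.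
  - rewrite /row_free mxrank_in_submod ?genmxE ?submxMl //.
    rewrite (eqmxMr A (val_submod1 W)) freeWA; exact: eqxx.
  rewrite -in_submodJ ?genmxE ?submxMl // -mulmxA -homA //.
  rewrite in_submodE mulmxA -in_submodE mulmxA -val_submodE.
  by rewrite -[submod_repr modW x]mul1mx val_submodJ // mulmxA.
have dx10 := mxtrace_submod1 (mxmodule1 r1) (eqmx_refl _).
have dx20 := mxtrace_submod1 (mxmodule1 r2) (eqmx_refl _).
have trKW := mxtrace_dadd_mod modK modW (mxmodule1 r1) defW dxW.
have trIC := mxtrace_dadd_mod modI modC (mxmodule1 r2) defC dxC.
have rCK : mx_rsim (submod_repr modK) (submod_repr modC).
  apply: IHn => [|x Gx].
    apply: leq_trans le_d1n; rewrite mxrank_ker -subn_gt0 subKn ?rank_leq_row //.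
    by rewrite lt0n mxrank_eq0.
  apply/(addrI (\tr (submod_repr modI x))); rewrite trIC // dx20 // -eq12 //.
  by rewrite -dx10 // -trKW // (mxtrace_rsim rWI) // addrC.
pose rK := Representation (submod_repr modK).
pose rW := Representation (submod_repr modW).
have sim1 : mx_rsim (submod_repr (mxmodule1 r1)) (dadd_grepr rK rW).
  by apply: (mx_rsim_dadd (rU := rK) (rV := rW) _ defW dxW); apply: mx_rsim_refl.
have sim2 : mx_rsim (submod_repr (mxmodule1 r2)) (dadd_grepr rK rW).
  apply: (mx_rsim_dadd (rU := rK) (rV := rW) _ _ _ (mx_rsim_sym rCK) (mx_rsim_sym rWI)).
    by rewrite addsmxC.
  by apply/mxdirect_addsP; rewrite capmxC; exact/mxdirect_addsP.
have sim10 := rsim_submod1 (mxmodule1 r1) (eqmx_refl _).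
have sim20 := rsim_submod1 (mxmodule1 r2) (eqmx_refl _).
apply: mx_rsim_trans (mx_rsim_trans (mx_rsim_sym sim10) sim1) _.
exact: mx_rsim_trans (mx_rsim_sym sim2) sim20.
Qed.

(* If [chi_i] is a constituent of [chi_l], comparing the multiplicities of
   [chi_i] on both sides of the regular character identity bounds
   [chi_l 1] by [chi_i 1], which forces [chi_l = chi_i]; no orthogonality
   relation between the [V l] has to be known beforehand. *)
Lemma regular_decomposition (I : finType) (V : I -> representation rat G) :
    (forall l, 0 < rdegree (V l))%N ->
    (forall x, x \in G ->
       \sum_l (rdegree (V l))%:R * \tr (V l x) = #|G|%:R *+ (x == 1%g)) ->
  [/\ forall l, qchar (V l) \in irr G,
      injective (fun l => qchar (V l))
    & forall i : Iirr G, exists l, 'chi_i = qchar (V l)].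
Proof.
move=> V_gt0 regV; pose chi l := qchar (V l).
have chiN l : chi l \is a character by exact: qchar_char.
have sum_chi : \sum_l chi l 1%g *: chi l = cfReg G.
  apply/cfun_inP=> x Gx; rewrite cfRegE sum_cfunE.
  rewrite -(rmorph_nat (@ratr algC)) -rmorphMn -regV // rmorph_sum.
  apply: eq_bigr => l _; rewrite cfunE /chi qchar1 qcharE // rmorphM.
  by rewrite rmorph_nat.
have mult i : \sum_l chi l 1%g * '[chi l, 'chi_i] = 'chi_i 1%g.
  transitivity '[cfReg G, 'chi_i].
    by rewrite -sum_chi cfdot_suml; apply: eq_bigr => l _; rewrite cfdotZl.
  rewrite cfReg_sum cfdot_suml (bigD1 i) //= big1 => [|j nj].
    by rewrite cfdotZl cfdot_irr eqxx mulr1 addr0.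
  by rewrite cfdotZl cfdot_irr (negPf nj) mulr0.
have term_ge0 l i : 0 <= chi l 1%g * '[chi l, 'chi_i].
  by rewrite mulr_ge0 ?char1_ge0 // natr_ge0 ?Cnat_cfdot_char_irr.
have constt i l : '[chi l, 'chi_i] != 0 -> chi l = 'chi_i.
  move=> nz; have il : i \in irr_constt (chi l) by [].
  have /(constt_charP i (chiN l))[phi phiN chiE] := il.
  have c_ge1 : 1 <= '[chi l, 'chi_i].
    move: nz; have /natrP[c ->] := Cnat_cfdot_char_irr i (chiN l).
    by rewrite pnatr_eq0 -lt0n ler1n.
  have : chi l 1%g <= 'chi_i 1%g.
    apply: le_trans (_ : chi l 1%g * '[chi l, 'chi_i] <= _).
      by rewrite ler_peMr ?char1_ge0.
    by rewrite -(mult i) (bigD1 l) //= lerDl sumr_ge0.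
  rewrite chiE cfunE gerDl => phi_le0.
  have /eqP : phi 1%g == 0 by rewrite eq_le phi_le0 char1_ge0.
  by move/eqP; rewrite char1_eq0 // => /eqP->; rewrite addr0.
have chi_irr l : exists i, chi l = 'chi_i.
  have : chi l != 0 by rewrite -char1_eq0 // qchar1 pnatr_eq0 -lt0n.
  by case/neq0_has_constt=> i; exists i; apply: constt.
split=> [l|l k|i].
- by have [i] := chi_irr l; rewrite /chi => ->; apply: mem_irr.
(* Two indices with the same character ['chi_i] would contribute ['chi_i 1] twice to a sum of
   nonnegative terms equal to ['chi_i 1]. *)
- rewrite -/(chi l) -/(chi k) => eq_lk; apply/eqP/idPn => nlk.
  have [i chil] := chi_irr l; have := mult i.
  rewrite (bigD1 l) //= (bigD1 k) 1?eq_sym //= -eq_lk chil cfdot_irr eqxx mulr1.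
  move/eqP; rewrite -[eqbRHS]addr0 (inj_eq (addrI _)).
  rewrite paddr_eq0 ?char1_ge0 ?irr_char ?sumr_ge0 //.
  by rewrite (negPf (irr1_neq0 i)).
have : \sum_l chi l 1%g * '[chi l, 'chi_i] != 0 by rewrite mult irr1_neq0.
case: (pickP (fun l => '[chi l, 'chi_i] != 0)) => [l /constt <- | z]; first by exists l.
by rewrite big1 ?eqxx // => l _; have /negbFE/eqP-> := z l; rewrite mulr0.
Qed.

(** The module form of [regular_decomposition]. The last clause compares traces: the inner sum has
    the regular character, and [k] copies of it match [rho]. *)
Theorem regular_family (I : finType) (V : I -> representation rat G) :
    (forall l, 0 < rdegree (V l))%N ->
    (forall x, x \in G ->
       \sum_l (rdegree (V l))%:R * \tr (V l x) = #|G|%:R *+ (x == 1%g)) ->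
  [/\ forall l, mx_irreducible (V l),
      forall l l', mx_rsim (V l) (V l') -> l = l',
      forall d (rho : reprQ d), mx_irreducible rho -> exists l, mx_rsim rho (V l)
    & forall k d (rho : reprQ d),
        (forall x, x \in G -> \tr (rho x) = k%:R * #|G|%:R *+ (x == 1%g)) ->
        mx_rsim rho (\big[dadd_grepr/grepr0]_(i < k)
          \big[dadd_grepr/grepr0]_l muln_grepr (V l) (rdegree (V l)))].
Proof.
move=> V_gt0 regV; have [chi_irr chi_inj chi_onto] := regular_decomposition V_gt0 regV.
(* Irreducibility holds first over [algC], where the character determines the module, and descends
   to the rationals because scalar extension preserves submodules. *)
have irrV l : mx_irreducible (V l).
  have /irr_reprP[rG irrG simG] := chi_irr l.
  have irrf := mx_rsim_irr (mx_rsim_sym (cfRepr_inj simG)) irrG.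
  apply: (@mxsimple_map _ _ (@ratr algC)); rewrite map_mx1; exact: irrf.
split=> // [l l' sim | d rho irr_rho | k d rho tr_rho].
- apply: chi_inj; apply/cfun_inP=> x Gx.
  by rewrite !qcharE // (mxtrace_rsim sim).
- have : qchar rho != 0.
    rewrite -char1_eq0 ?qchar_char // qchar1 pnatr_eq0 -lt0n.
    by case/mx_irrP: irr_rho.
  case/neq0_has_constt=> i; rewrite irr_consttE; have [l ->] := chi_onto i.
  by case/qchar_dot_hom=> A homA nzA; exists l; apply: intertwines_rsim homA nzA.
apply: eq_trace_rsim => x Gx; rewrite mxtrace_bigdadd.
rewrite sumr_const card_ord mxtrace_bigdadd tr_rho // -mulrnAr -regV // mulr_natl.
congr (_ *+ _); apply: eq_bigr => l _.
by rewrite /muln_grepr mxtrace_bigdadd sumr_const card_ord mulr_natl.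
Qed.

End RationalRepresentations.

(** * Polytabloids *)

Lemma card_ord_lt r k : (k <= r)%N -> #|[set i : 'I_r | (i < k)%N]| = k.
Proof.
move=> le_kr; rewrite -sum1dep_card -(big_ord_widen _ (fun=> 1%N) le_kr).
by rewrite sum1_card card_ord.
Qed.

Lemma down_closed_card r (P : pred 'I_r) (i : 'I_r) :
    (forall i j : 'I_r, (i <= j)%N -> P j -> P i) ->
  P i = (i < #|[set j | P j]|)%N.
Proof.
move=> downP; apply/idP/idP => [Pi|].
  rewrite -[X in (X <= _)%N](card_ord_lt (ltn_ord i)) subset_leq_card //.
  by apply/subsetP=> j; rewrite !inE ltnS => /downP; apply.
apply: contraLR => nPi; rewrite -leqNgt -(card_ord_lt (ltnW (ltn_ord i))).
rewrite subset_leq_card //; apply/subsetP=> j; rewrite !inE => Pj.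
by rewrite ltnNge; apply: contra nPi => /downP; apply.
Qed.

(** * Diagrams, conjugate partitions and cell weights *)

Section Partitions.
Variable r : nat.
Implicit Types p q : part r.

Lemma prow_le p i : (prow p i <= r)%N.
Proof. by rewrite -ltnS ltn_ord. Qed.

Lemma prow_anti p (i j : 'I_r) : (i <= j)%N -> (prow p j <= prow p i)%N.
Proof. by have /forallP/(_ i)/forallP/(_ j)/implyP := valP p. Qed.

Lemma part_inj p q : prow p =1 prow q -> p = q.
Proof. by move=> eqpq; apply/val_inj/ffunP=> i; apply/val_inj; apply: eqpq. Qed.

(** These are the parts of the conjugate partition. *)
Definition column_length p (j : 'I_r) := #|[set i : 'I_r | (j < prow p i)%N]|.

Lemma column_lengthE p (i j : 'I_r) : (j < prow p i)%N = (i < column_length p j)%N.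
Proof.
apply: (down_closed_card (P := fun i : 'I_r => (j < prow p i)%N)) => i1 i2 le_i.
by move/leq_trans; apply; apply: prow_anti.
Qed.

(* This statistic replaces the dominance order in James' argument. *)
Definition nstat p := (\sum_(i < r) i * prow p i)%N.

Definition diagram p := [set c : 'I_r * 'I_r | (c.2 < prow p c.1)%N].

Lemma sum_diagram p (f : 'I_r -> nat) :
  (\sum_(c in diagram p) f c.1 = \sum_i f i * prow p i)%N.
Proof.
transitivity (\sum_i \sum_(j < r | (j < prow p i)%N) f i)%N.
  by rewrite pair_big_dep /=; apply: eq_bigl => c; rewrite inE.
apply: eq_bigr => i _; rewrite sum_nat_const mulnC; congr (_ * _)%N.
by rewrite -[RHS](card_ord_lt (prow_le p i)) cardsE.
Qed.

Lemma card_diagram p : #|diagram p| = psize p.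
Proof.
rewrite -sum1_card (sum_diagram p (fun=> 1%N)).
by apply: eq_bigr => i _; rewrite mul1n.
Qed.

(* The diagram consists exactly of the cells of negative weight. *)
Definition cell_weight p (c : 'I_r * 'I_r) : int :=
  (c.1 : nat)%:Z - (column_length p c.2)%:Z.

(** Cells of the diagram weigh at most -1 and all others at least 0, so each diagram cell missing
    from [A] costs at least 1 and no extra cell gains anything. *)
Lemma diagram_extremal p (A : {set 'I_r * 'I_r}) :
  \sum_(c in diagram p) cell_weight p c + #|diagram p :\: A|%:Z
    <= \sum_(c in A) cell_weight p c.
Proof.
have wD c : c \in diagram p -> cell_weight p c + 1 <= 0.
  rewrite inE column_lengthE /cell_weight => lt_ch.
  by rewrite addrAC subr_le0 -PoszD lez_nat addn1.
have wND c : c \notin diagram p -> 0 <= cell_weight p c.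
  by rewrite inE column_lengthE /cell_weight -leqNgt subr_ge0 lez_nat.
rewrite (big_setID A) [leRHS](big_setID (diagram p)) /= setIC -addrA lerD2l.
apply: (@le_trans _ _ 0); last first.
  by apply: sumr_ge0 => c; rewrite inE => /andP[/wND].
rewrite -natz -sumr_const -big_split /=.
by apply: sumr_le0 => c; rewrite inE => /andP[_ /wD].
Qed.
End Partitions.

(** * James' argument with polytabloids *)

Section Tabloids.
Variables (T : finType) (r : nat).
Implicit Types (p q : part r) (R : tabloid T r) (t : tableau T r).

Local Notation act := (perm_repr_mx (tabloid_action T r)).

Definition tabloid_shape p R := [forall i, #|[set x | R x == i]| == prow p i].

Lemma tabloid_shapeP p R :
  reflect (forall i, #|[set x | R x == i]| = prow p i) (tabloid_shape p R).
Proof. exact: 'forall_eqP. Qed.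

Lemma tabloid_shape_inj p q R : tabloid_shape p R -> tabloid_shape q R -> p = q.
Proof.
move=> /tabloid_shapeP hp /tabloid_shapeP hq.
by apply: part_inj => i; rewrite -hp hq.
Qed.

Lemma tabloid_act_shape p R s :
  tabloid_shape p (tabloid_act R s) = tabloid_shape p R.
Proof.
apply: eq_forallb => i; congr (_ == _).
rewrite -(card_preimset _ (@perm_inj _ s)); apply: eq_card => x.
by rewrite !inE ffunE permK.
Qed.

Lemma sum_tabloid p R : tabloid_shape p R -> (\sum_x R x = nstat p)%N.
Proof.
move/tabloid_shapeP=> hR; rewrite (partition_big R xpredT) //=.
apply: eq_bigr => i _; rewrite -hR (eq_bigr (fun=> nat_of_ord i)) => [|x /eqP-> //].
by rewrite sum_nat_const mulnC cardsE.
Qed.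

Lemma tableau_injective p t : tableau_of_shape p t -> injective t.
Proof. by case/andP=> /injectiveP. Qed.

Lemma tableau_image p t : tableau_of_shape p t -> [set t x | x : T] = diagram p.
Proof. by case/andP=> _ /eqP. Qed.

Lemma tableau_mem p t x : tableau_of_shape p t -> t x \in diagram p.
Proof. by move/tableau_image <-; apply: imset_f. Qed.

Lemma tableau_onto p t c : tableau_of_shape p t -> c \in diagram p -> exists x, t x = c.
Proof. by move/tableau_image <-; case/imsetP=> x _ ->; exists x. Qed.

Lemma tableau_tabloid p t : tableau_of_shape p t -> tabloid_shape p (tabloid_of t).
Proof.
move=> ht; apply/tabloid_shapeP=> i.
rewrite -(card_imset _ (tableau_injective ht)) -(card_ord_lt (prow_le p i)).
have inj_i : injective (fun j : 'I_r => (i, j)) by move=> j k [].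
rewrite -[RHS](card_imset _ inj_i); apply: eq_card => c.
apply/imsetP/imsetP=> [[x] | [j]]; rewrite inE ?ffunE.
  move=> /eqP xi ->; have := tableau_mem x ht; rewrite !inE xi => lt_xp.
  by exists (t x).2; rewrite ?inE // -xi -surjective_pairing.
move=> lt_jp ->; have [|x tx] := tableau_onto ht (c := (i, j)); first by rewrite inE.
by exists x; rewrite // inE ffunE tx.
Qed.

Lemma card_tableau p t : tableau_of_shape p t -> #|T| = psize p.
Proof.
move=> ht; rewrite -card_diagram -(tableau_image ht).
by rewrite card_imset //; exact: tableau_injective ht.
Qed.

Lemma tableau_exists p : psize p = #|T| -> exists t, tableau_of_shape p t.
Proof.
rewrite -card_diagram => eqc.
pose t : tableau T r := [ffun x => enum_val (cast_ord (esym eqc) (enum_rank x))].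
have injt : injective t.
  by move=> x y; rewrite !ffunE => /enum_val_inj/cast_ord_inj/enum_rank_inj.
exists t; apply/andP; split; first exact/injectiveP.
rewrite eqEcard card_imset // eqc leqnn andbT.
by apply/subsetP=> _ /imsetP[x _ ->]; rewrite ffunE; exact: (enum_valP (cast_ord _ _)).
Qed.

Lemma tableau_transitive p t t' :
  tableau_of_shape p t -> tableau_of_shape p t' -> exists s, t' = tableau_act t s.
Proof.
move=> ht ht'; have /fin_all_exists[f hf] x : exists y, t y = t' x.
  by apply: (tableau_onto ht); apply: tableau_mem ht'.
have injf : injective f.
  by move=> x y eqf; apply: (tableau_injective ht'); rewrite -!hf eqf.
exists (perm injf)^-1%g; apply/ffunP=> x.
by rewrite ffunE invgK permE hf.
Qed.

(** Moving each letter [x] to row [R x] within its column of [t] fills a set [A] of cells. The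
    column part of the total weight is the same for [A] and for the diagram, so [diagram_extremal]
    compares only the row sums [nstat q] and [nstat p]. Equality forces [A] to be the diagram, and
    then the move is a column permutation. *)
Lemma injective_tabloid p q t R :
    tableau_of_shape p t -> tabloid_shape q R ->
    injective (fun x => (R x, (t x).2)) ->
  (nstat p <= nstat q)%N /\
  (nstat p = nstat q ->
     exists2 s, s \in column_stab t & R = tabloid_act (tabloid_of t) s).
Proof.
move=> ht hR; set c := fun x => _; move=> injc; pose A := [set c x | x : T].
have sumE (f : T -> 'I_r * 'I_r) :
    injective f -> (forall x, (f x).2 = (t x).2) ->
  \sum_(e in [set f x | x : T]) cell_weight p e =
    (\sum_x (f x).1)%N%:Z - (\sum_x column_length p (t x).2)%N%:Z.
  move=> injf f2; rewrite big_imset /=; last by move=> x y _ _; apply: injf.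
  rewrite -!natz !natr_sum -sumrB; apply: eq_bigr => x _.
  by rewrite /cell_weight f2 !natz.
have := diagram_extremal p A.
rewrite -{1}(tableau_image ht) (sumE t (tableau_injective ht)) // (sumE c injc) //.
rewrite addrAC lerD2r -PoszD lez_nat.
have -> : (\sum_x (t x).1 = nstat p)%N.
  by rewrite -(sum_tabloid (tableau_tabloid ht)); apply: eq_bigr => x _; rewrite ffunE.
rewrite (sum_tabloid hR) => le_pq.
split=> [|eq_pq]; first exact: leq_trans (leq_addr _ _) le_pq.
move: le_pq; rewrite eq_pq -{2}[nstat q]addn0 leq_add2l leqn0 cards_eq0 setD_eq0.
move=> sDA; have eqDA : diagram p = A.
  by apply/eqP; rewrite eqEcard sDA (card_imset _ injc) card_diagram (card_tableau ht) /=.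
(* [f x] is the letter that [t] has in the new cell of [x]; it lies in the column of [x], and the
   inverse of [f] is the required [s]. *)
have /fin_all_exists[f hf] x : exists y, t y = c x.
  by apply: (tableau_onto ht); rewrite eqDA imset_f.
have injf : injective f by move=> x y eqf; apply: injc; rewrite -!hf eqf.
exists (perm injf)^-1%g; last first.
  by apply/ffunP=> x; rewrite !ffunE invgK permE hf.
rewrite inE; apply/forallP=> x.
by rewrite -{2}(permKV (perm injf) x) [perm injf _]permE hf.
Qed.

(** The signed column sum of the tableau, as an operator on the tabloid module. *)
Definition kappa t : 'M[rat]_#|{: tabloid T r}| :=
  \sum_(s in column_stab t) (-1) ^+ s *: act s.

Lemma actM s s' : act s *m act s' = act (s * s')%g.
Proof. exact/esym/(repr_mxM (tabloid_repr T r) (in_setT s) (in_setT s')). Qed.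

Lemma polytabloidE t : polytabloid t = basis_vec (tabloid_of t) *m kappa t.
Proof.
rewrite mulmx_sumr; apply: eq_bigr => s _.
by rewrite -scalemxAr basis_vec_act.
Qed.

Lemma kappa_mull t s : s \in column_stab t -> act s *m kappa t = (-1) ^+ s *: kappa t.
Proof.
move=> Cs; have colM u : ((s * u)%g \in column_stab t) = (u \in column_stab t).
  rewrite !inE; apply/forallP/forallP=> h x.
    have := h (s^-1%g x); rewrite permM permKV => /eqP->.
    by move: Cs; rewrite inE => /forallP/(_ (s^-1%g x)); rewrite permKV eq_sym.
  by rewrite permM (eqP (h _)); move: Cs; rewrite inE => /forallP.
rewrite mulmx_sumr scaler_sumr [RHS](reindex_inj (mulgI s)) /=.
apply: eq_big => [u|u _]; first by rewrite colM.
rewrite -scalemxAr actM scalerA odd_permM signr_addb mulrA -signr_addb addbb.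
by rewrite mul1r.
Qed.

(** The transposition of [x] and [y] fixes [R] and is an odd element of the column stabilizer, so
    the vector equals its own negative. *)
Lemma kappa_collision t R x y :
    x != y -> R x = R y -> (t x).2 = (t y).2 ->
  basis_vec R *m kappa t = 0.
Proof.
move=> nxy eqR eqt; set v := _ *m _.
have Cxy : tperm x y \in column_stab t.
  by rewrite inE; apply/forallP=> z; case: tpermP => [->|->|_ _] //; rewrite eqt.
have actR : tabloid_act R (tperm x y) = R.
  by apply/ffunP=> z; rewrite ffunE tpermV; case: tpermP => [->|->|_ _] //; rewrite eqR.
have : v = - v.
  rewrite {1}/v -{1}actR -basis_vec_act -mulmxA kappa_mull // odd_tperm nxy.
  by rewrite expr1 scaleN1r mulmxN.
move/eqP; rewrite -subr_eq0 opprK -mulr2n -scaler_nat scaler_eq0 pnatr_eq0 /=.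
by move/eqP.
Qed.

(** By [kappa_collision], a nonzero product means that no two letters share both a row of [R] and a
    column of [t]; this is the injectivity required by [injective_tabloid]. *)
Lemma tabloid_kappa p q t R :
    tableau_of_shape p t -> tabloid_shape q R -> basis_vec R *m kappa t != 0 ->
  (nstat p <= nstat q)%N /\
  (nstat p = nstat q ->
     p = q /\ exists c, basis_vec R *m kappa t = c *: polytabloid t).
Proof.
move=> ht hR nz; have [|le_pq eq_pq] := injective_tabloid ht hR.
  move=> x y [eqR eqt]; apply/eqP/idPn => nxy.
  by case/eqP: nz; apply: kappa_collision nxy _ _.
split=> // /eq_pq[s Cs defR]; split.
  move: hR; rewrite defR tabloid_act_shape => hR.
  exact: tabloid_shape_inj (tableau_tabloid ht) hR.
exists ((-1) ^+ s); rewrite defR -basis_vec_act -mulmxA kappa_mull //.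
by rewrite -scalemxAr polytabloidE.
Qed.

(** Each generating polytabloid is supported on tabloids of shape [q], and vanishing of a coordinate
    is a linear condition, expressed by the kernel of the column [e]. *)
Lemma specht_support q (v : 'rV[rat]_#|{: tabloid T r}|) R :
  (v <= specht_mx T q)%MS -> v 0 (enum_rank R) != 0 -> tabloid_shape q R.
Proof.
move=> vS; apply: contraR => nqR.
pose e : 'cV[rat]_#|{: tabloid T r}| := delta_mx (enum_rank R) 0.
have coefE w : (w *m e) 0 0 = w 0 (enum_rank R).
  by rewrite -colE mxE.
suff /sub_kermxP ve0 : (v <= kermx e)%MS by rewrite -coefE ve0 mxE.
apply: submx_trans vS _; apply/sumsmx_subP=> t ht; rewrite genmxE.
apply/sub_kermxP/rowP=> i; rewrite !ord1 coefE mxE summxE big1 // => s _.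
rewrite !mxE /=; case: eqP => [/enum_rank_inj eqR|]; last by rewrite mulr0.
by rewrite eqR tabloid_act_shape (tableau_tabloid ht) in nqR.
Qed.

Section Hom.
Variables (q : part r) (F : 'M[rat]_#|{: tabloid T r}|).
Hypotheses (FM : forall s, act s *m F = F *m act s) (FS : (F <= specht_mx T q)%MS).

(** [F] commutes with [kappa t], so it may be applied to the single tabloid [tabloid_of t] first;
    the result lies in the Specht module of [q], hence is supported on shape [q]. *)
Lemma hom_polytabloid t :
  polytabloid t *m F =
    \sum_(R | tabloid_shape q R)
      (basis_vec (tabloid_of t) *m F) 0 (enum_rank R) *: (basis_vec R *m kappa t).
Proof.
have kF : kappa t *m F = F *m kappa t.
  rewrite mulmx_suml mulmx_sumr; apply: eq_bigr => s _.
  by rewrite -scalemxAl -scalemxAr FM.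
rewrite polytabloidE -mulmxA kF mulmxA; set v := basis_vec _ *m F.
have vE : v = \sum_(R | tabloid_shape q R) v 0 (enum_rank R) *: basis_vec R.
  rewrite {1}(row_sum_delta v) (reindex _ (onW_bij _ (@enum_rank_bij _))) /=.
  rewrite (bigID (tabloid_shape q)) /= [X in _ + X]big1 ?addr0 // => R nqR.
  have [->|nz] := eqVneq (v 0 (enum_rank R)) 0; first by rewrite scale0r.
  case/negP: nqR; apply: specht_support nz.
  by apply: submx_trans FS; apply: submxMl.
by rewrite {1}vE mulmx_suml; apply: eq_bigr => R _; rewrite scalemxAl.
Qed.

(** A nonvanishing term in [hom_polytabloid] would give [nstat p <= nstat q], hence equality, hence
    [p = q]. *)
Lemma specht_hom_neq p : p != q -> (nstat q <= nstat p)%N -> specht_mx T p *m F = 0.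
Proof.
move=> npq le_qp; apply/sub_kermxP/sumsmx_subP=> t ht; rewrite genmxE.
apply/sub_kermxP; rewrite hom_polytabloid big1 // => R hR.
have [->|nz] := eqVneq (basis_vec R *m kappa t) 0; first by rewrite scaler0.
have [le_pq eq_pq] := tabloid_kappa ht hR nz.
have [|eqpq _] := eq_pq; first by apply/eqP; rewrite eqn_leq le_pq.
by rewrite eqpq eqxx in npq.
Qed.

Lemma specht_hom_scalar : exists c, specht_mx T q *m F = c *: specht_mx T q.
Proof.
case: (pickP (tableau_of_shape q : pred (tableau T r))) => [t ht | no_t]; last first.
  by exists 0; rewrite scale0r /specht_mx big_pred0 // mul0mx.
have [c tF] : exists c, polytabloid t *m F = c *: polytabloid t.
  rewrite hom_polytabloid.
  have scal R : tabloid_shape q R -> exists c, basis_vec R *m kappa t = c *: polytabloid t.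
    move=> hR; have [->|nz] := eqVneq (basis_vec R *m kappa t) 0.
      by exists 0; rewrite scale0r.
    by have [_ [//|_]] := tabloid_kappa ht hR nz.
  elim/big_ind: _ => [|u v [a ->] [b ->]|R /scal[a ->]].
  - by exists 0; rewrite scale0r.
  - by exists (a + b); rewrite scalerDl.
  by rewrite scalerA; eexists; reflexivity.
(* The scalar found for one tableau serves for all of them: they form a single orbit and [F]
   commutes with the action. *)
exists c; apply/eqP; rewrite -mul_mx_scalar -subr_eq0 -mulmxBr; apply/eqP.
apply/sub_kermxP/sumsmx_subP=> t' ht'; rewrite genmxE; apply/sub_kermxP.
have [s ->] := tableau_transitive ht ht'; rewrite -polytabloid_act.
rewrite -[tabloid_repr T r s]/(act s) mulmxBr -mulmxA FM mulmxA tF mul_mx_scalar -scalemxAl.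
by rewrite subrr.
Qed.

End Hom.

(** The tabloid of [t] has coefficient 1 in [polytabloid t]: a column permutation that also
    preserves all rows fixes every letter. *)
Lemma specht_degree p : psize p = #|T| -> (0 < \rank (specht_mx T p))%N.
Proof.
case/tableau_exists=> t ht; rewrite lt0n mxrank_eq0.
have : polytabloid t 0 (enum_rank (tabloid_of t)) != 0.
  rewrite summxE (bigD1 1%g) /=; last by rewrite inE; apply/forallP=> x; rewrite perm1.
  rewrite big1 ?addr0 => [|s /andP[Cs ns]].
    rewrite !mxE odd_perm1 (_ : tabloid_act _ _ = tabloid_of t) ?eqxx ?mulr1 //.
    by apply/ffunP=> x; rewrite !ffunE invg1 perm1.
  rewrite !mxE /=; case: eqP => [/enum_rank_inj eqt|]; last by rewrite mulr0.
  case/eqP: ns; apply/permP=> x; rewrite perm1; apply: (tableau_injective ht).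
  move: Cs; rewrite inE => /forallP/(_ x)/eqP col.
  have := congr1 (fun R : tabloid T r => R (s x)) eqt; rewrite !ffunE permK => row.
  by rewrite [LHS]surjective_pairing [RHS]surjective_pairing col row.
apply: contraNneq => S0.
suff /eqP-> : polytabloid t == 0 by rewrite mxE.
rewrite -submx0 -S0 (sumsmx_sup t) // genmxE; exact: submx_refl.
Qed.

End Tabloids.

(** * Characters of the symmetric groups *)

Lemma card_permT (T : finType) : #|{: {perm T}}| = #|T|`!.
Proof.
rewrite -(cardsT T) -card_perm; apply: eq_card => u.
by apply/esym/subsetP=> x _; rewrite inE.
Qed.

Section CycleType.
Variable T : finType.
Implicit Types s u : {perm T}.

Lemma perm_expg_eq s x i j :
  ((s ^+ i)%g x == (s ^+ j)%g x) = (i == j %[mod #|porbit s x|]).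
Proof.
set n := #|_|; have n_gt0 : (0 < n)%N by rewrite lt0n card_porbit_neq0.
have modE k : (s ^+ k)%g x = nth x (traject s x n) (k %% n).
  rewrite nth_traject ?ltn_mod // {1}(divn_eq k n) addnC permX iterD.
  congr iter; elim: (k %/ n)%N => // q IHq.
  by rewrite mulSn iterD IHq iter_porbit.
rewrite !modE nth_uniq ?size_traject ?ltn_mod //.
exact: uniq_traject_porbit.
Qed.

Definition porbits_of_size s k := [set B in porbits s | #|B| == k].
Definition porbits_above s k := [set B in porbits s | (k < #|B|)%N].

Lemma card_porbits_above s k :
  (#|porbits_above s k| = #|porbits_of_size s k.+1| + #|porbits_above s k.+1|)%N.
Proof.
rewrite -(cardsID [set B : {set T} | #|B| == k.+1]); congr (_ + _)%N.
  apply: eq_card => B; rewrite !inE -andbA; congr (_ && _).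
  by case: eqP => [->|]; rewrite ?ltnSn ?andbF.
apply: eq_card => B; rewrite !inE andbCA; congr (_ && _).
by rewrite [RHS]ltn_neqAle eq_sym.
Qed.

Lemma card_porbits_le s : (#|porbits s| <= #|T|)%N.
Proof. exact: leq_imset_card. Qed.

Lemma sum_porbits s : (\sum_(B in porbits s) #|B| = #|T|)%N.
Proof.
rewrite -[RHS]sum1_card (partition_big (porbit s) (mem (porbits s))) /=; last first.
  by move=> x _; apply: imset_f.
apply: eq_bigr => _ /imsetP[y _ ->]; rewrite sum1dep_card.
by apply: eq_card => x; rewrite !inE eq_porbit_mem.
Qed.

Lemma porbit_eq s B x : B \in porbits s -> x \in B -> B = porbit s x.
Proof. by case/imsetP=> y _ ->; rewrite -eq_porbit_mem => /eqP->. Qed.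

Lemma porbits_matching s u :
    (forall k, #|porbits_of_size s k| = #|porbits_of_size u k|) ->
  exists h : {set T} -> {set T},
    [/\ {in porbits s, forall B, h B \in porbits u},
        {in porbits s, forall B, #|h B| = #|B|}
      & {in porbits s &, injective h}].
Proof.
move=> eq_su.
(* [h] matches orbits of equal size by their position in the two enumerations; [set0] is only the
   default of [nth]. *)
pose h (B : {set T}) := nth set0 (enum (porbits_of_size u #|B|))
                     (index B (enum (porbits_of_size s #|B|))).
have hP B : B \in porbits s ->
    [/\ h B \in porbits_of_size u #|B|,
        (index B (enum (porbits_of_size s #|B|)) < #|porbits_of_size u #|B| |)%N
      & B \in enum (porbits_of_size s #|B|)].
  move=> sB; have eB : B \in enum (porbits_of_size s #|B|).
    by rewrite mem_enum inE sB eqxx.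
  have lt_B : (index B (enum (porbits_of_size s #|B|)) < #|porbits_of_size u #|B| |)%N.
    by rewrite -eq_su [#|porbits_of_size _ _|]cardE index_mem.
  by split=> //; rewrite -mem_enum mem_nth // -cardE.
exists h; split=> [B /hP[]|B /hP[]|B C sB sC eqh].
- by rewrite inE => /andP[].
- by rewrite inE => /andP[_ /eqP].
have [hB ltB eB] := hP B sB; have [hC ltC eC] := hP C sC.
have eq_card : #|B| = #|C|.
  move: hB hC; rewrite !inE => /andP[_ /eqP <-] /andP[_ /eqP <-].
  by rewrite eqh.
move: eqh ltB eB; rewrite /h eq_card => /eqP + ltB eB.
rewrite nth_uniq ?enum_uniq -?cardE // => /eqP eq_index.
by rewrite -(nth_index set0 eB) -[RHS](nth_index set0 eC) eq_index.
Qed.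

(** With a base point in each orbit of [s] and in the matched orbit of [u], the conjugating
    permutation sends the [i]-th power of [s] at the first to the [i]-th power of [u] at the second.
    Equal orbit sizes make this independent of the exponent chosen. *)
Lemma same_cycle_conj s u :
    (forall k, #|porbits_of_size s k| = #|porbits_of_size u k|) ->
  u \in (s ^: [set: {perm T}])%g.
Proof.
case/porbits_matching=> h [h_in h_card h_inj].
(* The fallback [x] occurs only for empty [B], so on orbits the chosen point depends on [B]
   alone. *)
pose base (B : {set T}) (x : T) := odflt x [pick y in B].
have baseP (B : {set T}) x y : y \in B -> base B x \in B.
  by rewrite /base; case: pickP => //= z; rewrite z.
have base_eq (B : {set T}) x x' y : y \in B -> base B x = base B x'.
  by rewrite /base; case: pickP => //= z; rewrite z.
pose b x := base (porbit s x) x; pose b' x := base (h (porbit s x)) x.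
have sB x : porbit s x \in porbits s by apply: imset_f.
have b_in x : b x \in porbit s x by apply: baseP (porbit_id s x).
have hB x : h (porbit s x) = porbit u (b' x).
  apply: porbit_eq; first exact: h_in.
  have : (0 < #|h (porbit s x)|)%N by rewrite h_card // lt0n card_porbit_neq0.
  by case/card_gt0P=> y; apply: baseP.
have b_eq x y : porbit s x = porbit s y -> b x = b y /\ b' x = b' y.
  rewrite /b /b' => ->; split; first exact: base_eq (porbit_id s y).
  by apply: (base_eq _ _ _ (b' y)); rewrite hB porbit_id.
have card_b x : #|porbit s (b x)| = #|porbit u (b' x)|.
  by rewrite -hB h_card //; have := b_in x; rewrite -eq_porbit_mem => /eqP->.
have /fin_all_exists[e he] x : exists i, x = (s ^+ i)%g (b x).
  by apply/porbitP; rewrite porbit_sym.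
have transfer x i j : ((s ^+ i)%g (b x) == (s ^+ j)%g (b x))
                    = ((u ^+ i)%g (b' x) == (u ^+ j)%g (b' x)).
  by rewrite !perm_expg_eq card_b.
pose f x := (u ^+ e x)%g (b' x).
have porbit_f x : porbit u (f x) = h (porbit s x) by rewrite hB porbit_perm.
have injf : injective f.
  move=> x y eqf; have eqB : porbit s x = porbit s y.
    by apply: h_inj => //; rewrite -!porbit_f eqf.
  have [eqb eqb'] := b_eq x y eqB.
  rewrite (he x) (he y) -eqb; apply/eqP; rewrite transfer.
  by move: eqf; rewrite /f -eqb' => ->.
have f_s x : f (s x) = u (f x).
  have eqB : porbit s (s x) = porbit s x by apply: (porbit_perm s 1).
  have [eqb eqb'] := b_eq _ _ eqB.
  rewrite /f -permM -expgSr eqb'; apply/eqP; rewrite -transfer -{1}eqb -he.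
  by rewrite expgSr permM -he.
apply/imsetP; exists (perm injf); first by rewrite inE.
apply/permP=> x; rewrite -[x](permKV (perm injf)); set y := _ x.
by rewrite permJ [X in u X]permE [RHS]permE f_s.
Qed.

Variable r : nat.
Hypothesis le_Tr : (#|T| <= r)%N.

(* The conjugate of the partition formed by the cycle lengths. *)
Definition cycle_ffun s : {ffun 'I_r -> 'I_r.+1} :=
  [ffun i : 'I_r => inord #|porbits_above s i|].

Lemma cycle_ffunE s i : cycle_ffun s i = #|porbits_above s i| :> nat.
Proof.
rewrite ffunE inordK // ltnS; apply: leq_trans le_Tr.
apply: leq_trans (card_porbits_le s); apply: subset_leq_card.
by apply/subsetP=> B; rewrite inE => /andP[].
Qed.

Lemma cycle_part_subproof s :
  [forall i : 'I_r, forall j : 'I_r, (i <= j)%N ==> (cycle_ffun s j <= cycle_ffun s i)%N].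
Proof.
apply/'forall_forallP=> i j; apply/implyP=> le_ij; rewrite !cycle_ffunE.
apply: subset_leq_card; apply/subsetP=> B; rewrite !inE => /andP[-> /=].
exact: leq_ltn_trans.
Qed.

Definition cycle_part s : part r := exist _ (cycle_ffun s) (cycle_part_subproof s).

Lemma prow_cycle_part s i : prow (cycle_part s) i = #|porbits_above s i|.
Proof. exact: cycle_ffunE. Qed.

Lemma psize_cycle_part s : psize (cycle_part s) = #|T|.
Proof.
rewrite /psize -(sum_porbits s).
under eq_bigr do rewrite prow_cycle_part -sum1dep_card.
rewrite (exchange_big_dep (mem (porbits s))) /=; last by move=> i B _ /andP[].
apply: eq_bigr => B sB; under eq_bigl do rewrite sB.
rewrite -[RHS](@card_ord_lt r) ?sum1dep_card //.
exact: leq_trans (max_card _) le_Tr.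
Qed.

(** The number of cycles of a given length is the difference of two consecutive parts, so the cycle
    type can be recovered. *)
Lemma cycle_part_conj s u : cycle_part s = cycle_part u -> u \in (s ^: [set: {perm T}])%g.
Proof.
move=> eq_su; apply: same_cycle_conj.
have above k : #|porbits_above s k| = #|porbits_above u k|.
  case: (ltnP k r) => [lt_kr | le_rk].
    by have := congr1 (fun p => prow p (Ordinal lt_kr)) eq_su; rewrite !prow_cycle_part.
  (* [cycle_part] stores nothing at indices from [r] on, but no cycle is longer than [#|T| <= r]. *)
  have none v : porbits_above v k = set0.
    apply/setP=> B; rewrite !inE andbC ltnNge (leq_trans (max_card _)) //.
    exact: leq_trans le_rk.
  by rewrite !none.
case=> [|k].
  have none v : porbits_of_size v 0 = set0.
    apply/setP=> B; rewrite !inE; apply/negP=> /andP[/imsetP[x _ ->]].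
    by rewrite (negPf (card_porbit_neq0 v x)).
  by rewrite !none.
apply: (@addIn #|porbits_above s k.+1|).
by rewrite -card_porbits_above !above card_porbits_above.
Qed.

Lemma card_classes_perm :
  (#|classes [set: {perm T}]| <= #|[set p : part r | psize p == #|T| ]|)%N.
Proof.
pose c (B : {set {perm T}}) := cycle_part (repr B).
rewrite -(card_in_imset (f := c)) => [|B C].
  apply: subset_leq_card; apply/subsetP=> _ /imsetP[B _ ->].
  by rewrite inE psize_cycle_part.
case/imsetP=> s _ -> /imsetP[u _ ->] /cycle_part_conj.
have [x _ ->] := repr_class [set: {perm T}] s.
have [y _ ->] := repr_class [set: {perm T}] u.
by move/class_eqP; rewrite !classGidl ?inE.
Qed.

End CycleType.

(** * Irreducibility and completeness of the Specht modules *)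

Section SpechtCharacters.
Variables (T : finType) (r : nat).
Implicit Types p q : part r.
Local Notation spechtQ := (@specht_repr T r).
Local Notation act := (tabloid_repr T r).

(** James' argument needs maps defined on all tabloids. A Maschke complement gives an equivariant
    projection [P] onto the source, and [A] is composed with it. *)
Lemma specht_hom_extension p q A :
    intertwines (spechtQ p) (spechtQ q) A ->
  exists F, [/\ forall s, act s *m F = F *m act s, (F <= specht_mx T q)%MS
    & val_submod (1%:M : 'M_(\rank (specht_mx T p))) *m F = val_submod A].
Proof.
set U := specht_mx T p => homA; have modU : mxmodule act U := specht_mxmodule T p.
have [W modW defW dxW] := ratG_completely_reducible modU (submx1 _).
pose P := proj_mx U W; have sPU : (P <= U)%MS.
  by rewrite -[P]mul1mx proj_mx_sub.
have homP s : act s *m P = P *m act s.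
  have /hom_mxP/(_ s (in_setT s)) : (1%:M <= dom_hom_mx act P)%MS.
    by rewrite -defW proj_mx_hom //; apply/mxdirect_addsP.
  by rewrite !mul1mx.
exists (val_submod (in_submod U P *m A)); split=> [s||].
- rewrite -(val_submodJ (specht_mxmodule T q)) ?inE //.
  rewrite -[submod_mx _ s]/(spechtQ q s) -(mulmxA (in_submod U P)) -homA ?inE //.
  rewrite (mulmxA (in_submod U P)).
  rewrite -[spechtQ p s]/(submod_mx modU s) -in_submodJ // -homP.
  by rewrite /val_submod /in_submod /= !mulmxA.
- exact: val_submodP.
rewrite [LHS]mulmxA [RHS]/(_ *m _); congr (_ *m _); rewrite mulmxA.
rewrite in_submodE mulmxA -in_submodE proj_mx_id ?val_submodP //; last first.
  exact/mxdirect_addsP.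
by rewrite val_submodK mul1mx.
Qed.

Lemma specht_hom0 p q A :
    p != q -> (nstat q <= nstat p)%N -> intertwines (spechtQ p) (spechtQ q) A ->
  A = 0.
Proof.
move=> npq le_qp /specht_hom_extension[F [homF FS FA]].
apply/eqP; rewrite -val_submod_eq0 -FA; apply/eqP.
have /submxP[X ->] := val_submodP (1%:M : 'M_(\rank (specht_mx T p))).
by rewrite -mulmxA (specht_hom_neq homF FS npq le_qp) mulmx0.
Qed.

Lemma specht_hom_is_scalar p A :
  intertwines (spechtQ p) (spechtQ p) A -> is_scalar_mx A.
Proof.
move=> /specht_hom_extension[F [homF FS FA]].
have [c Fc] := specht_hom_scalar homF FS.
apply/is_scalar_mxP; exists c; apply: val_submod_inj; rewrite -FA.
have /submxP[X eX] := val_submodP (1%:M : 'M_(\rank (specht_mx T p))).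
by rewrite [RHS]val_submodE mul_scalar_mx eX -mulmxA Fc scalemxAr.
Qed.

Lemma qchar_specht_irr p : psize p = #|T| -> qchar (spechtQ p) \in irr [set: {perm T}].
Proof.
move=> sz_p; rewrite irrEchar qchar_char qchar_norm1 ?eqxx //.
  exact: specht_degree.
exact: specht_hom_is_scalar.
Qed.

Lemma qchar_specht_inj p q :
  psize p = #|T| -> qchar (spechtQ p) = qchar (spechtQ q) -> p = q.
Proof.
move=> sz_p eq_pq; apply/eqP/idPn => npq.
have nz : '[qchar (spechtQ p)] != 0.
  by rewrite cfnorm_eq0; have /irrP[i ->] := qchar_specht_irr sz_p; apply: irr_neq0.
(* [specht_hom0] excludes homomorphisms in one direction only, determined by the order of the two
   statistics; equal characters would give nonzero ones in both. *)
case/orP: (leq_total (nstat p) (nstat q)) => le_pq.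
  have : '[qchar (spechtQ q), qchar (spechtQ p)] != 0 by rewrite -eq_pq.
  case/qchar_dot_hom=> A /(specht_hom0 _ le_pq)-> //; first by rewrite eqxx.
  by rewrite eq_sym.
have : '[qchar (spechtQ p), qchar (spechtQ q)] != 0 by rewrite -eq_pq.
by case/qchar_dot_hom=> A /(specht_hom0 npq le_pq)->; rewrite eqxx.
Qed.

Hypothesis le_Tr : (#|T| <= r)%N.

(** The Specht characters are irreducible and distinct, and by [card_classes_perm] there are at
    least as many as classes. Hence they are all the irreducible characters, and the sum is the
    regular character. *)
Theorem specht_regular (s : {perm T}) :
  \sum_(p : part r | psize p == #|T|)
      (\rank (specht_mx T p))%:R * \tr (spechtQ p s) = #|T|`!%:R *+ (s == 1%g).
Proof.
pose P := [set p : part r | psize p == #|T|].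
have /fin_all_exists[f hf] (i : Iirr [set: {perm T}]) :
    exists p, p \in P /\ 'chi_i = qchar (spechtQ p).
  have charP p : p \in P -> exists i : Iirr [set: {perm T}], qchar (spechtQ p) = 'chi_i.
    by rewrite inE => /eqP/qchar_specht_irr/irrP.
  have /fin_all_exists[g hg] p : exists i : Iirr [set: {perm T}],
      p \in P -> qchar (spechtQ p) = 'chi_i.
    by case: (boolP (p \in P)) => [/charP[j ->] | _]; [exists j | exists 0].
  have injg : {in P &, injective g}.
    move=> p q Pp Pq eqg; apply: qchar_specht_inj; last by rewrite !hg ?eqg.
    by move: Pp; rewrite inE => /eqP.
  have gP : g @: P = [set: Iirr [set: {perm T}]].
    apply/eqP; rewrite eqEcard subsetT (card_in_imset injg) cardsT card_ord NirrE /=.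
    exact: card_classes_perm.
  have : i \in g @: P by rewrite gP inE.
  by case/imsetP=> p Pp ->; exists p; rewrite hg.
have injf : injective f.
  move=> i j eqf; apply: irr_inj; have [_ ->] := hf i; have [_ ->] := hf j.
  by rewrite eqf.
have imf : P = f @: [set: Iirr [set: {perm T}]].
  apply/setP=> p; apply/idP/imsetP=> [Pp | [i _ ->]]; last by case: (hf i).
  have sz_p : psize p = #|T| by move: Pp; rewrite inE => /eqP.
  have /irrP[i chi_p] := qchar_specht_irr sz_p; exists i => //.
  by apply: qchar_specht_inj => //; rewrite chi_p; case: (hf i).
apply: (fmorph_inj (@ratr algC)).
rewrite rmorphMn rmorph_nat -card_permT -(cardsT {perm T}) -cfRegE cfReg_sum.
rewrite sum_cfunE rmorph_sum.
rewrite (eq_bigl (mem P)) => [|p]; last by rewrite /= inE.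
rewrite imf big_imset /=; last by move=> i j _ _; apply: injf.
rewrite (eq_bigl xpredT) => [|i]; last by rewrite inE.
apply: eq_bigr => i _; rewrite cfunE rmorphM rmorph_nat.
by have [_ ->] := hf i; rewrite qchar1 qcharE ?inE.
Qed.

End SpechtCharacters.

(** * Traces of tensor and induced modules *)

Section SubmoduleTrace.
Variables (gT : finGroupType) (G : {group gT}) (d : nat).
Variable rG : mx_representation rat G d.

(** The hypotheses make [P] a projection onto [V], so traces on [V] can be computed in the ambient
    module without choosing a basis of [V]. *)
Lemma mxtrace_submod_proj (V P : 'M_d) (modV : mxmodule rG V) x :
    x \in G -> (P <= V)%MS -> V *m P = V ->
  \tr (submod_repr modV x) = \tr (P *m rG x).
Proof.
move=> Gx sPV VP; pose B := val_submod (1%:M : 'M_(\rank V)) *m rG x.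
transitivity (\tr (B *m in_submod V P)); last first.
  by rewrite mxtrace_mulC mulmxA -val_submodE in_submodK.
have /submxP[C eB] : (B <= V)%MS by exact: mxmodule_trans modV Gx (val_submodP _).
have -> : B *m in_submod V P = in_submod V (B *m P) by exact: mulmxA.
by rewrite eB -mulmxA VP -eB.
Qed.

Definition proj_onto (V : 'M[rat]_d) : 'M_d := proj_mx V V^C%MS.

Lemma proj_onto_sub V : (proj_onto V <= V)%MS.
Proof. by rewrite -[proj_onto V]mul1mx proj_mx_sub. Qed.

Lemma proj_onto_id V : V *m proj_onto V = V.
Proof. exact: proj_mx_id (capmx_compl V) (submx_refl V). Qed.
End SubmoduleTrace.

Section InducedTrace.
Variables (gT : finGroupType) (H G : {group gT}) (d : nat).
Variable rH : mx_representation rat H d.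
Hypothesis sHG : H \subset G.

Lemma ext_mx_trace_conj h z : h \in H ->
  \tr (ext_mx rH (h * z * h^-1)%g) = \tr (ext_mx rH z).
Proof.
move=> Hh; rewrite /ext_mx -mulgA groupMl // groupMr ?groupV //.
case: ifP => // Hz; rewrite !repr_mxM ?groupM ?groupV // mxtrace_mulC -mulmxA.
by rewrite -repr_mxM ?groupV // mulVg repr_mx1 mulmx1.
Qed.

(** Frobenius' formula, with the denominator cleared: the summand is constant on each right coset of
    [H]. *)
Lemma mxtrace_induced x : x \in G ->
  #|H|%:R * \tr (induced_repr rH sHG x)
    = \sum_(y in G) \tr (ext_mx rH (y * x * y^-1)%g).
Proof.
move=> Gx; rewrite /= mxtrace_mxblock mulr_sumr.
rewrite [RHS](partition_big (fun y => H :* y)%g (mem (rcosets H G))) /=; last first.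
  by move=> y Gy; apply/rcosetsP; exists y.
have coset_sum C : C \in rcosets H G ->
    \sum_(y in G | (H :* y)%g == C) \tr (ext_mx rH (y * x * y^-1)%g)
      = #|H|%:R * \tr (ext_mx rH (repr C * x * (repr C)^-1)%g).
  case/rcosetsP=> z Gz ->; have Hr : (repr (H :* z) * z^-1 \in H)%g.
    by rewrite -mem_rcoset; exact: mem_repr_rcoset.
  rewrite (eq_bigr (fun=> \tr (ext_mx rH (repr (H :* z) * x * (repr (H :* z))^-1)%g))).
    rewrite sumr_const mulr_natl -(card_rcoset H z); congr (_ *+ _).
    apply: eq_card => y; rewrite unfold_in; apply/andP/idP => [[_ /eqP <-]|].
      exact: rcoset_refl.
    case/rcosetP=> h Hh ->; split; first exact: groupM (subsetP sHG _ Hh) Gz.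
    by rewrite rcosetM rcoset_id.
  move=> y /andP[Gy /eqP Hy]; have Hrz : (repr (H :* z) * y^-1 \in H)%g.
    by rewrite -mem_rcoset Hy; exact: mem_repr_rcoset.
  rewrite -(ext_mx_trace_conj _ Hrz) !invMg invgK !mulgA; congr (\tr (ext_mx _ _)).
  by rewrite !mulgKV.
rewrite [RHS](eq_bigr _ coset_sum).
rewrite [RHS]big_enum_val; apply: eq_bigr => i _.
by rewrite /coset_rep.
Qed.
End InducedTrace.

Section TensorTrace.
Variables (m n : nat) (X : finType) (to : {action 'S_m &-> X}).
Local Notation N := #|X|.
Local Notation families := {ffun 'I_n -> X}.

(** The tensor product of the operators [P i], given by the images of the basis vectors. *)
Definition tens_op (P : 'I_n -> 'M[rat]_N) : 'M[rat]_#|{: families}| :=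
  \matrix_a tens (fun i => row (enum_rank ((enum_val a : families) i)) (P i)).

Lemma tens_mul (v : 'I_n -> 'rV[rat]_N) (P : 'I_n -> 'M[rat]_N) :
  tens v *m tens_op P = tens (fun i => v i *m P i).
Proof.
rewrite tensE mulmx_suml; apply/rowP=> j; rewrite summxE [RHS]mxE.
under [RHS]eq_bigr do rewrite mxE (reindex _ (onW_bij _ (@enum_rank_bij _))).
rewrite bigA_distr_bigA /=; apply: eq_bigr => f _.
rewrite -scalemxAl /basis_vec -rowE rowK !mxE big_split; congr (_ * _).
by apply: eq_bigr => i _; rewrite !mxE enum_rankK.
Qed.

Lemma tens_op_sub (V P : 'I_n -> 'M[rat]_N) :
  (forall i, P i <= V i)%MS -> (tens_op P <= tensor_mx V)%MS.
Proof.
move=> sPV; apply/row_subP=> a; rewrite rowK; apply: tens_sub => i.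
exact: submx_trans (row_sub _ _) (sPV i).
Qed.

Lemma tensor_mx_mul (V P : 'I_n -> 'M[rat]_N) :
  (forall i, V i *m P i = V i) -> tensor_mx V *m tens_op P = tensor_mx V.
Proof.
move=> VP; apply/eqP; rewrite -subr_eq0 -[X in _ - X]mulmx1 -mulmxBr; apply/eqP.
apply/sub_kermxP/sumsmx_subP=> a _; rewrite genmxE; apply/sub_kermxP.
rewrite mulmxBr mulmx1 tens_mul; apply/eqP; rewrite subr_eq0; apply/eqP.
apply/rowP=> j; rewrite !mxE; apply: eq_bigr => i _.
by rewrite -row_mul VP.
Qed.

Lemma mxtrace_tens_op (P : 'I_n -> 'M[rat]_N) (w : wreath m n) :
    wr_pi w = 1%g ->
  \tr (tens_op P *m perm_repr (wr_action n to) w)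
    = \prod_i \tr (P i *m perm_repr to (wr_sigma w i)).
Proof.
move=> pi1; rewrite /mxtrace.
under [RHS]eq_bigr do rewrite (reindex _ (onW_bij _ (@enum_rank_bij _))).
rewrite bigA_distr_bigA /= (reindex _ (onW_bij _ (@enum_rank_bij _))) /=.
apply: eq_bigr => f _.
have -> (A : 'M[rat]_#|{: families}|) :
    A (enum_rank f) (enum_rank f) = (row (enum_rank f) A) 0 (enum_rank f).
  by rewrite mxE.
rewrite row_mul rowK tens_act enum_rankK mxE enum_rankK; apply: eq_bigr => i _.
by rewrite pi1 invg1 perm1 -row_mul mxE.
Qed.

End TensorTrace.

(** * Block patterns *)

Local Notation ord_le := (fun i j : 'I_ _ => (i <= j)%N).

Section Words.
Variables (n K : nat).
Implicit Types c f : n.-tuple 'I_K.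

Definition word_stab c : {set 'S_n} :=
  [set s : 'S_n | [forall i, tnth c (s i) == tnth c i]].

Definition word_perm c (s : 'S_n) : n.-tuple 'I_K := [tuple tnth c (s i) | i < n].

Lemma word_stabP c (s : 'S_n) :
  reflect (forall i, tnth c (s i) = tnth c i) (s \in word_stab c).
Proof. by rewrite inE; apply: 'forall_eqP. Qed.

Definition sort_word f : n.-tuple 'I_K := [tuple of sort ord_le f].

Lemma perm_sort_word f : perm_eq (sort_word f) f.
Proof. by rewrite perm_sort. Qed.

(** Sorted words serve as representatives of the orbits of ['S_n] on words. *)
Lemma sorted_wordP c : sorted ord_le c -> forall f,
  reflect (exists s, f = word_perm c s) (sort_word f == c).
Proof.
move=> c_sorted f; apply: (iffP eqP) => [<-|[s ->]].
  have /tuple_permP[s fE] : perm_eq f (sort_word f).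
    by rewrite perm_sym perm_sort_word.
  by exists s; apply: val_inj.
apply/val_inj => /=; apply: (sorted_eq (leT := ord_le)) => //.
- by move=> i j k; apply: leq_trans.
- by move=> i j /anti_leq/val_inj.
- by apply: sort_sorted => i j; apply: leq_total.
by rewrite perm_sort; apply/tuple_permP; exists s.
Qed.

(** The fibres of [word_perm c] are the cosets [s0 * word_stab c], and its image is the orbit of
    [c]. *)
Lemma sum_word_perm c (h : n.-tuple 'I_K -> rat) :
    sorted ord_le c ->
  \sum_(s : 'S_n) h (word_perm c s)
    = #|word_stab c|%:R * \sum_(f | sort_word f == c) h f.
Proof.
move=> c_sorted.
rewrite (partition_big (word_perm c) (fun f => sort_word f == c)) => [|s _]; last first.
  by apply/sorted_wordP => //; exists s.
rewrite mulr_sumr; apply: eq_bigr => f /(sorted_wordP c_sorted)[s0 ->].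
rewrite (eq_bigr (fun=> h (word_perm c s0))) => [|s /andP[_ /eqP-> //]].
rewrite sumr_const mulr_natl; congr (_ *+ _).
rewrite -(card_imset (mem (word_stab c)) (mulgI s0)).
apply: eq_card => s; rewrite unfold_in; apply/eqP/imsetP => [eqs | [u /word_stabP cu ->]].
  exists (s0^-1 * s)%g; last by rewrite mulKVg.
  apply/word_stabP=> i; rewrite permM.
  have := congr1 (fun f => tnth f (s0^-1%g i)) (val_inj eqs).
  by rewrite !tnth_mktuple permKV.
by apply/(congr1 val)/eq_from_tnth => i; rewrite !tnth_mktuple permM cu.
Qed.

(** * Order of the stabilizer of a word *)

Section StabilizerOrder.
Variable c : n.-tuple 'I_K.
Local Notation block k := {i : 'I_n | tnth c i == k}.

Lemma card_block k : #|{: block k}| = count_mem k c.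
Proof.
rewrite card_sig -sum1_card -sum1_count big_tuple.
by apply: eq_bigl => i; rewrite inE.
Qed.

Definition block_restr k (s : 'S_n) : {perm block k} :=
  actperm_morphism (subaction (block k) 'P) s.

Lemma val_block_restr k s (i : block k) :
  s \in word_stab c -> val (block_restr k s i) = s (val i).
Proof.
move=> /word_stabP cs; rewrite /block_restr /= actpermE /= val_subact.
by rewrite /= ifT // !inE; apply/subsetP=> j; rewrite !inE /= /aperm cs.
Qed.

Lemma block_restr1 s : s \in word_stab c ->
  (s == 1%g) = [forall k, block_restr k s == 1%g].
Proof.
move=> cs; apply/eqP/forallP => [-> k|triv_s].
  apply/eqP/permP=> i; apply: val_inj; rewrite val_block_restr ?perm1 //.
  by apply/word_stabP=> j; rewrite perm1.
apply/permP=> i; rewrite perm1; have /eqP s1 := triv_s (tnth c i).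
by rewrite -[s i](val_block_restr (exist _ i (eqxx (tnth c i))) cs) s1 perm1.
Qed.

(** Restriction to the blocks is a bijection from the stabilizer to the product of the symmetric
    groups of the blocks. *)
Lemma card_word_stab : #|word_stab c| = (\prod_k (count_mem k c)`!)%N.
Proof.
pose F s : {dffun forall k, {perm block k}} := [ffun k => block_restr k s].
rewrite -(card_in_imset (f := F)) => [|s u cs cu /ffunP eqF].
  have -> : F @: word_stab c = setT.
    apply/setP=> g; rewrite inE; apply/imsetP.
    (* The preimage of [g] is obtained by gluing its components, each applied on its own block. *)
    pose s0 i := val (g (tnth c i) (exist _ i (eqxx (tnth c i)))).
    have s0E k (i : block k) : s0 (val i) = val (g k i).
      case: i => i eik; have ek := eqP eik; rewrite /s0 /=; case: k / ek eik => eik.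
      by congr (val (g _ _)); apply: val_inj.
    have cs0 i : tnth c (s0 i) = tnth c i.
      by rewrite /s0; apply/eqP/(valP (g _ _)).
    have inj_s0 : injective s0.
      move=> i j eqij; have ecij : tnth c i = tnth c j by rewrite -cs0 eqij cs0.
      have := s0E _ (exist _ i (introT eqP ecij)); rewrite /= eqij.
      rewrite -[j]/(val (exist (fun i => tnth c i == tnth c j) j (eqxx _))) s0E.
      by move/val_inj/perm_inj/(congr1 val).
    have cs : perm inj_s0 \in word_stab c by apply/word_stabP=> i; rewrite permE.
    exists (perm inj_s0) => //; apply/ffunP=> k; apply/permP=> i; apply: val_inj.
    by rewrite ffunE val_block_restr // permE s0E.
  rewrite cardsT card_dep_ffun foldrE big_map big_enum /=; apply: eq_bigr => k _.
  by rewrite -card_block card_permT.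
apply/permP=> i; pose i' : block (tnth c i) := exist _ i (eqxx (tnth c i)).
rewrite -[s i](val_block_restr i' cs) -[u i](val_block_restr i' cu).
by have := eqF (tnth c i); rewrite !ffunE => ->.
Qed.

End StabilizerOrder.
End Words.

(** * Block words and orders of the wreath products *)

Section BlockWord.
Variables m n : nat.
Local Notation K := (nparts m).
Implicit Types (l : multipart m n) (c : n.-tuple 'I_K).

Definition block_tuple l : n.-tuple 'I_K := Tuple (size_block_word l).

Lemma count_block_word l k : count_mem k (block_tuple l) = psize (val l k).
Proof.
rewrite /= /block_word count_flatten -map_comp sumnE big_map big_enum /=.
rewrite (bigD1 k) //= count_nseq /= eqxx mul1n big1 ?addn0 // => j nj.
by rewrite count_nseq /= (negPf nj).
Qed.

Lemma sorted_block_word l : sorted ord_le (block_tuple l).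
Proof.
have leT_tr : transitive ord_le by move=> i j k; apply: leq_trans.
have sorted_nseq a (k : 'I_K) : pairwise ord_le (nseq a k).
  by elim: a => //= a ->; rewrite andbT; apply/allP=> i /nseqP[-> _].
rewrite sorted_pairwise //= /block_word.
have : pairwise ord_le (enum 'I_K).
  rewrite -sorted_pairwise //.
  by have := iota_sorted 0 K; rewrite -val_enum_ord sorted_map.
elim: (enum _) => //= k s IHs /andP[/allP le_ks /IHs sorted_s].
rewrite pairwise_cat sorted_nseq sorted_s !andbT.
apply/allrelP=> i j /nseqP[-> _] /flattenP[_ /mapP[k' sk' ->]] /nseqP[-> _].
exact: le_ks.
Qed.

(** A sorted word is determined by its letter counts. Fixing the block word thus fixes only the
    sizes of the partitions, which then vary independently. *)
Lemma block_tupleP l c : sorted ord_le c ->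
  (block_tuple l == c) = [forall k, psize (val l k) == count_mem k c].
Proof.
move=> c_sorted; apply/eqP/'forall_eqP => [<- k|eq_lc].
  by rewrite count_block_word.
apply/val_inj; apply: (sorted_eq (leT := ord_le)) => //.
- by move=> i j k; apply: leq_trans.
- by move=> i j /anti_leq/val_inj.
- exact: sorted_block_word.
apply/allP=> k _; rewrite /= -[count_mem k (block_word l)]/(count_mem k (block_tuple l)).
by rewrite count_block_word eq_lc.
Qed.

Lemma young_word_stab l : young l = word_stab (block_tuple l) :> {set 'S_n}.
Proof.
apply/setP=> s; apply/idP/word_stabP=> [ys i | cs]; first exact: young_block ys.
apply/bigcapP=> k _; rewrite !inE; apply/subsetP=> i; rewrite !inE /= /aperm.
by rewrite /block cs.
Qed.

Lemma sum_wreath (F : {ffun 'I_n -> 'S_m} -> 'S_n -> rat) :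
  \sum_(w : wreath m n) F (wr_sigma w) (wr_pi w) = \sum_s \sum_p F s p.
Proof.
rewrite pair_big (reindex (@pair_wreath m n)) //.
by exists (@wreath_pair m n) => [[s p]|[s p]].
Qed.

Lemma card_wreath : #|{: wreath m n}| = (m`! ^ n * n`!)%N.
Proof.
apply/eqP; rewrite -(eqr_nat rat) -sumr_const (sum_wreath (fun _ _ => 1)).
by rewrite !sumr_const card_ffun !card_permT !card_ord -mulrnA eqr_nat mulnC.
Qed.

Lemma card_wr_young l : #|wr_young l| = (m`! ^ n * #|word_stab (block_tuple l)|)%N.
Proof.
apply/eqP; rewrite -(eqr_nat rat) -sumr_const.
rewrite (eq_bigl (fun w : wreath m n => wr_pi w \in young l)) => [|w]; last first.
  by rewrite !inE.
rewrite big_mkcond (sum_wreath (fun _ p => if p \in young l then 1 else 0)).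
rewrite sumr_const -big_mkcond sumr_const -mulrnA young_word_stab.
by rewrite card_ffun card_permT !card_ord mulnC.
Qed.

End BlockWord.

(** * Characters of the wreath product *)

Lemma sum_subtype (T : finType) (P : pred T) (sT : subFinType P) (Q : pred T)
    (F : T -> rat) :
  \sum_(u : sT | Q (val u)) F (val u) = \sum_(x | P x && Q x) F x.
Proof.
rewrite [RHS](reindex_omap (val : sT -> T) insub) /= => [|x /andP[Px _]]; last first.
  by rewrite insubT /= SubK.
by apply: eq_bigl => u; rewrite valK eqxx (valP u) andbT.
Qed.

Section WreathTrace.
Variables m n : nat.
Local Notation K := (nparts m).
Variable mu : 'I_K -> intpart m.
Implicit Types (l : multipart m n) (c : n.-tuple 'I_K).

Definition base_dim k := \rank (specht_mx 'I_m (val (mu k))).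
Definition base_trace k (s : 'S_m) := \tr (specht_repr 'I_m (val (mu k)) s).

Lemma base_trace1 k : base_trace k 1%g = (base_dim k)%:R.
Proof. by rewrite /base_trace repr_mx1 mxtrace1. Qed.

Lemma base_traceJ k s u : base_trace k (u * s * u^-1)%g = base_trace k s.
Proof.
rewrite /base_trace !repr_mxM ?inE // mxtrace_mulC mulmxA -repr_mxM ?inE //.
by rewrite mulVg repr_mx1 mul1mx.
Qed.

Lemma base_regular (hmu : bijective mu) s :
  \sum_k (base_dim k)%:R * base_trace k s = m`!%:R *+ (s == 1%g).
Proof.
have := @specht_regular 'I_m m; rewrite card_ord => /(_ (leqnn m) s) <-.
pose F (p : part m) : rat := (\rank (specht_mx 'I_m p))%:R * \tr (specht_repr 'I_m p s).
rewrite -(reindex mu (P := xpredT) (F := fun q : intpart m => F (val q))) /=; last first.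
  exact: onW_bij.
by rewrite (@sum_subtype _ _ (intpart m) xpredT F); apply: eq_bigl => p; rewrite andbT.
Qed.

Definition specht_projection c (i : 'I_n) :=
  proj_onto (specht_mx 'I_m (val (mu (tnth c i)))).

(** The character of [Dtilde_repr], written through a projection so that it is defined for every
    word [c] and every [w], also outside [wr_young]. *)
Definition base_char c (w : wreath m n) :=
  \tr (tens_op (specht_projection c)
         *m perm_repr (wr_action n (tabloid_action 'I_m m)) w).

Lemma base_charE c w : wr_pi w = 1%g ->
  base_char c w = \prod_i base_trace (tnth c i) (wr_sigma w i).
Proof.
move=> pi1; rewrite /base_char mxtrace_tens_op //; apply: eq_bigr => i _.
rewrite /base_trace (mxtrace_submod_proj (P := specht_projection c i)) ?inE //.
  exact: proj_onto_sub.
exact: proj_onto_id.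
Qed.

Lemma mxtrace_Dtilde l w : w \in wr_young l ->
  \tr (Dtilde_repr mu l w) = base_char (block_tuple l) w.
Proof.
move=> Hw; rewrite (mxtrace_submod_proj
  (P := tens_op (specht_projection (block_tuple l)))) //.
  by apply: tens_op_sub => i; apply: proj_onto_sub.
by apply: tensor_mx_mul => i; apply: proj_onto_id.
Qed.

Definition factor_trace c k (p : part n) (s : 'S_n) :=
  \tr (specht_repr {i : 'I_n | tnth c i == k} p (block_restr c k s)).

Lemma factor_trace1 c k p :
  factor_trace c k p 1%g = (\rank (specht_mx {i : 'I_n | tnth c i == k} p))%:R.
Proof.
have c1 : 1%g \in word_stab c by apply/word_stabP=> i; rewrite perm1.
rewrite /factor_trace; have /eqP -> : block_restr c k 1%g == 1%g.
  by move: (block_restr1 c1); rewrite eqxx => /esym/forallP.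
by rewrite repr_mx1 mxtrace1.
Qed.

Lemma mxtrace_young l s :
  \tr (young_specht l s) = \prod_k factor_trace (block_tuple l) k (val l k) s.
Proof.
apply: (big_morph (fun r : representation rat (young l) => \tr (r s))) => [r1 r2|].
  exact: mxtrace_prod.
exact: mxtrace1.
Qed.

(** The character of the module to be induced, extended by zero. The family [p] is separate from
    [c], so that it can be summed over while [c] stays fixed. *)
Definition inner_trace c (p : {ffun 'I_K -> part n}) (w : wreath m n) : rat :=
  if wr_pi w \in word_stab c
  then base_char c w * \prod_k factor_trace c k (p k) (wr_pi w) else 0.

Lemma mxtrace_ext l w :
  \tr (ext_mx (prod_repr (Dtilde_repr mu l) (Dprime_repr l)) w)
    = inner_trace (block_tuple l) (val l) w.
Proof.
rewrite /ext_mx /inner_trace -young_word_stab.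
have -> : (w \in wr_young l) = (wr_pi w \in young l) by rewrite !inE.
case: ifP => Hw; last exact: mxtrace0.
rewrite [LHS]mxtrace_prod mxtrace_Dtilde ?inE //; congr (_ * _).
exact: mxtrace_young.
Qed.

Lemma mxtrace_wreath l w :
  #|wr_young l|%:R * \tr (wreath_specht mu l w)
    = \sum_y inner_trace (block_tuple l) (val l) (y * w * y^-1)%g.
Proof.
rewrite mxtrace_induced ?inE //.
rewrite (eq_bigl xpredT) => [|y]; last by rewrite inE.
by apply: eq_bigr => y _; apply: mxtrace_ext.
Qed.

Lemma wreath_degree l :
  #|wr_young l|%:R * (rdegree (wreath_specht mu l))%:R
    = #|{: wreath m n}|%:R * inner_trace (block_tuple l) (val l) 1%g :> rat.
Proof.
rewrite -[(rdegree _)%:R]mxtrace1 -(repr_mx1 (wreath_specht mu l)) mxtrace_wreath.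
rewrite (eq_bigr (fun=> inner_trace (block_tuple l) (val l) 1%g)) => [|y _].
  by rewrite sumr_const mulr_natl.
by rewrite mulg1 mulgV.
Qed.

Lemma factor_sum c k s : s \in word_stab c ->
  \sum_(p : part n | psize p == count_mem k c)
     factor_trace c k p 1%g * factor_trace c k p s
    = (count_mem k c)`!%:R *+ (block_restr c k s == 1%g).
Proof.
move=> cs; have le_n : (#|{: {i : 'I_n | tnth c i == k}}| <= n)%N.
  by rewrite card_block -[leqRHS](size_tuple c) count_size.
have := specht_regular le_n (block_restr c k s); rewrite card_block => <-.
by apply: eq_bigr => p _; rewrite factor_trace1.
Qed.

(** The partitions are chosen independently for each block, so the sum is a product of regular
    characters of the block symmetric groups, that is, the regular character of the Young
    subgroup. *)
Lemma factor_prod_sum c s : s \in word_stab c ->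
  \sum_(p : {ffun 'I_K -> part n} | [forall k, psize (p k) == count_mem k c])
     (\prod_k factor_trace c k (p k) 1%g) * (\prod_k factor_trace c k (p k) s)
    = #|word_stab c|%:R *+ (s == 1%g).
Proof.
move=> cs.
under eq_bigr do rewrite -big_split /=.
transitivity (\prod_k \sum_(p : part n | psize p == count_mem k c)
    factor_trace c k p 1%g * factor_trace c k p s).
  rewrite bigA_distr_big_dep; apply: eq_bigl => p; rewrite unfold_in.
  by apply/forallP/familyP.
rewrite (eq_bigr _ (fun k _ => factor_sum k cs)).
rewrite (block_restr1 cs) card_word_stab natr_prod.
case: (boolP [forall _, _]) => [/forallP triv|].
  by apply: eq_bigr => k _; rewrite triv.
by rewrite negb_forall => /existsP[k nk]; rewrite (bigD1 k) //= (negPf nk) mul0r.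
Qed.

End WreathTrace.

(** * The regular character of the wreath product *)

Section WreathRegular.
Variables m n : nat.
Local Notation K := (nparts m).
Variable mu : 'I_K -> intpart m.
Implicit Types (l : multipart m n) (c : n.-tuple 'I_K) (w : wreath m n).

Lemma sum_count_mem c : (\sum_k count_mem k c = n)%N.
Proof.
rewrite -[RHS]card_ord -sum1_card (partition_big (tnth c) xpredT) //=.
by apply: eq_bigr => k _; rewrite -sum1_count big_tuple.
Qed.

(** [base_char] does not depend on the partitions, so only the Young factors are summed, and
    [factor_prod_sum] leaves just the elements with trivial [wr_pi]. *)
Lemma inner_sum c w : sorted ord_le c ->
  \sum_(l | block_tuple l == c)
      inner_trace mu c (val l) 1%g * inner_trace mu c (val l) w
    = (#|word_stab c|%:R * (base_char mu c 1%g * base_char mu c w)) *+ (wr_pi w == 1%g).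
Proof.
move=> c_sorted; under eq_bigl do rewrite block_tupleP //.
rewrite (@sum_subtype _ _ (multipart m n)
  (fun p => [forall k, psize (p k) == count_mem k c])
  (fun p => inner_trace mu c p 1%g * inner_trace mu c p w)).
(* The total size required of a [multipart] is automatic, since the letter counts of [c] add up to
   [n]. *)
rewrite (eq_bigl (fun p : {ffun 'I_K -> part n} =>
  [forall k, psize (p k) == count_mem k c])); last first.
  move=> p; case: (boolP [forall k, _]) => [/'forall_eqP sz|]; rewrite ?andbF ?andbT //.
  by rewrite (eq_bigr _ (fun k _ => sz k)) sum_count_mem eqxx.
have c1 : 1%g \in word_stab c by apply/word_stabP=> i; rewrite perm1.
rewrite /inner_trace (_ : wr_pi 1%g = 1%g) // c1.
case: (boolP (wr_pi w \in word_stab c)) => [cw|ncw]; last first.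
  rewrite big1 => [|p _]; last by rewrite mulr0.
  by have [pi1|//] := eqVneq (wr_pi w) 1%g; rewrite pi1 c1 in ncw.
under eq_bigr do rewrite mulrACA.
by rewrite -mulr_sumr (factor_prod_sum cw) mulrnAr mulrC.
Qed.

(** Conjugating by [y] permutes the tensor factors, which amounts to permuting the word, and
    conjugates each component, which leaves its trace unchanged. *)
Lemma base_charJ c w y : wr_pi w = 1%g ->
  base_char mu c (y * w * y^-1)%g
    = \prod_j base_trace mu (tnth (word_perm c (wr_pi y)^-1%g) j) (wr_sigma w j).
Proof.
move=> pi1; rewrite base_charE; last by rewrite /= pi1 mulg1 mulgV.
rewrite (reindex_inj (@perm_inj _ (wr_pi y)^-1%g)) /=; apply: eq_bigr => j _.
rewrite tnth_mktuple !ffunE /= pi1 invgK !permKV invg1 perm1.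
exact: base_traceJ.
Qed.

Lemma card_wreath_gt0 : #|{: wreath m n}|%:R != 0 :> rat.
Proof. by rewrite card_wreath pnatr_eq0 -lt0n muln_gt0 expn_gt0 !fact_gt0. Qed.

Lemma word_stab_neq0 c : #|word_stab c|%:R != 0 :> rat.
Proof.
rewrite pnatr_eq0 -lt0n; apply/card_gt0P; exists 1%g.
by apply/word_stabP=> i; rewrite perm1.
Qed.

Lemma wreath_block_sum c w : sorted ord_le c ->
  \sum_(l | block_tuple l == c)
      (rdegree (wreath_specht mu l))%:R * \tr (wreath_specht mu l w)
    = (n`!%:R * \sum_(f | sort_word f == c)
        \prod_j ((base_dim mu (tnth f j))%:R * base_trace mu (tnth f j) (wr_sigma w j)))
      *+ (wr_pi w == 1%g).
Proof.
move=> c_sorted; pose h (f : n.-tuple 'I_K) :=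
  \prod_j ((base_dim mu (tnth f j))%:R * base_trace mu (tnth f j) (wr_sigma w j)).
pose mn : rat := (m`! ^ n)%:R; pose st : rat := #|word_stab c|%:R.
have mn0 : mn != 0 by rewrite pnatr_eq0 -lt0n expn_gt0 fact_gt0.
have st0 : st != 0 by exact: word_stab_neq0.
have GE : #|{: wreath m n}|%:R = mn * n`!%:R by rewrite card_wreath natrM.
transitivity ((mn * st)^-1 ^+ 2 * (mn * n`!%:R) * \sum_y \sum_(l | block_tuple l == c)
    inner_trace mu c (val l) 1%g * inner_trace mu c (val l) (y * w * y^-1)%g).
  rewrite exchange_big mulr_sumr; apply: eq_bigr => l /eqP lc.
  have Tc : #|wr_young l|%:R = mn * st by rewrite card_wr_young lc natrM.
  have := mxtrace_wreath mu l w; have := wreath_degree mu l.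
  rewrite Tc GE lc; set d := (rdegree _)%:R; set t := \tr _.
  rewrite -mulr_sumr => degE <-.
  apply: (@mulfI _ ((mn * st) ^+ 2)); first by rewrite expf_neq0 ?mulf_neq0.
  rewrite [RHS]mulrA [X in _ = X * _]mulrA exprVn mulfV ?expf_neq0 ?mulf_neq0 // mul1r.
  by rewrite [RHS]mulrA -degE expr2 mulrACA.
rewrite (eq_bigr _ (fun y _ => inner_sum (y * w * y^-1)%g c_sorted)).
have piJ y : (wr_pi (y * w * y^-1)%g == 1%g) = (wr_pi w == 1%g).
  by rewrite /= -eq_mulgV1 -{2}[wr_pi y]mulg1 (inj_eq (mulgI _)).
under eq_bigr do rewrite piJ.
rewrite sumrMnl; case: (eqVneq (wr_pi w) 1%g) => [pi1|_]; last by rewrite !mulr0n mulr0.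
rewrite !mulr1n -mulr_sumr.
(* The identity is rewritten as [y * 1 * y^-1], so that both characters become products over the
   same permuted word. *)
have hE y : base_char mu c 1%g * base_char mu c (y * w * y^-1)%g
    = h (word_perm c (wr_pi y)^-1%g).
  rewrite base_charJ // -{1}(mulgV y) -{1}[y in (y * _)%g]mulg1 base_charJ //.
  rewrite -big_split; apply: eq_bigr => j _ /=.
  by rewrite ffunE base_trace1.
rewrite (eq_bigr _ (fun y _ => hE y)) (sum_wreath (fun _ p => h (word_perm c p^-1%g))).
rewrite sumr_const card_ffun card_permT !card_ord.
rewrite -(reindex_inj invg_inj (P := xpredT) (F := fun p => h (word_perm c p))) /=.
rewrite (sum_word_perm h c_sorted) -[_ *+ _]mulr_natl -/mn -/st.
set S := \sum_(f | _) _.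
by field; rewrite mn0 st0.
Qed.

(** Every word has exactly one sorted rearrangement, so the block sums combine into a sum over all
    words. That sum factors over the [n] positions into regular characters of ['S_m]. *)
Theorem wreath_regular (hmu : bijective mu) w :
  \sum_l (rdegree (wreath_specht mu l))%:R * \tr (wreath_specht mu l w)
    = #|[set: wreath m n]|%:R *+ (w == 1%g).
Proof.
rewrite (partition_big (@block_tuple m n) (fun c => sorted ord_le c)) /=; last first.
  by move=> l _; apply: sorted_block_word.
rewrite (eq_bigr _ (fun c cs => wreath_block_sum w cs)) sumrMnl -mulr_sumr.
pose h (f : n.-tuple 'I_K) :=
  \prod_j ((base_dim mu (tnth f j))%:R * base_trace mu (tnth f j) (wr_sigma w j)).
have <- : \sum_f h f = \sum_(c : n.-tuple 'I_K | sorted ord_le c)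
    \sum_(f | sort_word f == c) h f.
  apply: (partition_big (@sort_word n K)) => f _.
  by apply: sort_sorted => i j; apply: leq_total.
have -> : \sum_f h f = \prod_(j < n) (m`!%:R *+ (wr_sigma w j == 1%g)).
  rewrite -(eq_bigr _ (fun j _ => base_regular hmu (wr_sigma w j))).
  rewrite bigA_distr_bigA (reindex (fun g : {ffun 'I_n -> 'I_K} => [tuple g i | i < n])) /=.
    by apply: eq_bigr => g _; apply: eq_bigr => j _; rewrite tnth_mktuple.
  exists (fun f => [ffun i => tnth f i]) => [g _|f _].
    by apply/ffunP=> i; rewrite ffunE tnth_mktuple.
  by apply: eq_from_tnth => i; rewrite tnth_mktuple ffunE.
rewrite cardsT card_wreath.
have [->|nw] := eqVneq w 1%g.
  under eq_bigr do rewrite ffunE eqxx.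
  by rewrite prodr_const card_ord eqxx natrM natrX mulrC.
have [pi1|_] := eqVneq (wr_pi w) 1%g; last by rewrite !mulr0n.
have /existsP[j nj] : [exists j, wr_sigma w j != 1%g].
  rewrite -negb_forall; apply: contra nw => /forallP s1.
  by apply/eqP/wreathP => // i; rewrite ffunE; apply/eqP.
by rewrite (bigD1 j) //= (negPf nj) mul0r mulr0.
Qed.

End WreathRegular.

(** * The profile module *)

(** By [wreath_degree] it suffices that the inducing character is nonzero at the identity, where it
    is a product of degrees of nonzero Specht modules. *)
Lemma wreath_specht_degree m n (mu : 'I_(nparts m) -> intpart m) (l : multipart m n) :
  (0 < rdegree (wreath_specht mu l))%N.
Proof.
suff: #|wr_young l|%:R * (rdegree (wreath_specht mu l))%:R != 0 :> rat.
  by apply: contra_neqT; rewrite -eqn0Ngt => /eqP->; rewrite mulr0.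
rewrite wreath_degree mulf_neq0 ?card_wreath_gt0 // /inner_trace ifT; last first.
  by apply/word_stabP=> i; rewrite perm1.
rewrite base_charE // mulf_neq0 //; apply/prodf_neq0=> i _.
  rewrite ffunE base_trace1 pnatr_eq0 -lt0n specht_degree // card_ord.
  exact/eqP/(valP (mu _)).
by rewrite factor_trace1 pnatr_eq0 -lt0n specht_degree // card_block count_block_word.
Qed.

Section Profile.
Variables m n : nat.

Lemma mxtrace_perm_repr (gT : finGroupType) (X : finType) (to : {action gT &-> X}) g :
  \tr (perm_repr to g) = #|[set x | to x g == x]|%:R.
Proof.
rewrite /mxtrace (reindex _ (onW_bij _ (@enum_rank_bij _))) /=.
rewrite -sum1dep_card natr_sum [RHS]big_mkcond; apply: eq_bigr => x _.
by rewrite !mxE /= enum_rankK eq_sym (inj_eq enum_rank_inj); case: eqP.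
Qed.

Lemma card_ranking : #|{: ranking m n}| = (m ^ n)`!.
Proof.
have card_c : #|{: committee m n}| = (m ^ n)%N by rewrite card_ffun !card_ord.
rewrite card_sig -ffactnn -[X in (X ^_ _)%N]card_c -card_uniq_tuples.
by apply: eq_card => t; rewrite !inE all_predT.
Qed.

(** A ranking lists every committee once, so fixing it fixes all committees. Constant committees
    then force each [wr_sigma w i] to be trivial. *)
Lemma ranking_free (hm : (2 <= m)%N) (t : ranking m n) (w : wreath m n) :
  ranking_action m n t w = t -> w = 1%g.
Proof.
move=> fix_t; have fixR (R : committee m n) : wr_act (perm_action 'I_m) R w = R.
  have mem_t : R \in val t.
    have : #|val t| = #|{: committee m n}|.
      by rewrite (card_uniqP (valP t)) size_tuple card_ffun !card_ord.
    by move/subset_cardP/(_ (subset_predT _)) => ->.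
  have := congr1 (fun t : ranking m n => val (val t)) fix_t => /= eqt.
  have /(congr1 (fun s => nth R s (index R (val t)))) := eqt.
  by rewrite (nth_map R) ?index_mem // nth_index.
have fixE (R : committee m n) i : wr_sigma w i (R ((wr_pi w)^-1%g i)) = R i.
  by have := congr1 (fun R : committee m n => R i) (fixR R); rewrite ffunE.
apply: wreathP => [i|] /=.
  rewrite ffunE; apply/permP=> k; rewrite perm1.
  by have := fixE [ffun=> k] i; rewrite !ffunE.
apply/permP=> i; rewrite perm1.
pose k0 : 'I_m := Ordinal (ltnW hm); pose k1 : 'I_m := Ordinal hm.
(* A committee with [k1] in department [i] and [k0] elsewhere detects whether [wr_pi w] moves [i];
   two distinct candidates exist because [m] is at least 2. *)
have := fixE [ffun j => if j == i then k1 else k0] i.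
have -> : wr_sigma w i = 1%g.
  apply/permP=> k; rewrite perm1.
  by have := fixE [ffun=> k] i; rewrite !ffunE.
rewrite perm1 !ffunE eqxx; case: eqP => // eqi _.
by rewrite -{1}eqi permKV.
Qed.

(** All orbits of a free action have the order of the group as their size. The quotient counting the
    copies is therefore exact. *)
Lemma card_wreath_dvd (hm : (2 <= m)%N) : (m`! ^ n * n`! %| (m ^ n)`!)%N.
Proof.
rewrite -card_wreath -card_ranking -[#|{: ranking m n}|]cardsT.
have acts_all : [acts [set: wreath m n], on [set: ranking m n] | ranking_action m n].
  by apply/subsetP=> w _; rewrite !inE; apply/subsetP=> t _; rewrite !inE.
rewrite -(acts_sum_card_orbit acts_all); apply: dvdn_sum => _ /imsetP[t _ ->].
rewrite -cardsT -(card_orbit_stab (ranking_action m n) [set: wreath m n]%G t).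
suff -> : #|'C_[set: wreath m n][t | ranking_action m n]| = 1%N by rewrite muln1.
apply/eqP/cards1P; exists 1%g; apply/setP=> w; rewrite in_setI in_setT in_set1.
apply/astab1P/eqP=> [/(ranking_free hm) // | ->]; exact: act1.
Qed.

Lemma mxtrace_profile (hm : (2 <= m)%N) (w : wreath m n) :
  \tr (profile_repr m n w) =
    ((m ^ n)`! %/ (m`! ^ n * n`!))%:R * #|[set: wreath m n]|%:R *+ (w == 1%g).
Proof.
rewrite mxtrace_perm_repr cardsT card_wreath -natrM divnK ?card_wreath_dvd //.
have [->|nw] := eqVneq w 1%g.
  rewrite -card_ranking -cardsT; congr _%:R; apply: eq_card => t.
  by rewrite !inE act1 eqxx.
rewrite (_ : [set x | _] = set0) ?cards0 //; apply/setP=> t; rewrite !inE.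
by apply: contraNF nw => /eqP/(ranking_free hm)->.
Qed.

End Profile.

(** The first three clauses make precise that [l] runs over one copy of each simple module, for an
    arbitrary enumeration [mu] of the partitions of [m]; the fourth is the decomposition. *)
Theorem theorem3p7 (m n : nat) (hm : (2 <= m)%N) (hn : (1 <= n)%N)
    (mu : 'I_(nparts m) -> intpart m) (hmu : bijective mu) :
  [/\ forall l : multipart m n, mx_irreducible (wreath_specht mu l),
      forall l l' : multipart m n,
        mx_rsim (wreath_specht mu l) (wreath_specht mu l') -> l = l',
      forall (d : nat) (rho : mx_representation rat [set: wreath m n]%G d),
        mx_irreducible rho ->
        exists l : multipart m n, mx_rsim rho (wreath_specht mu l)
    & mx_rsim (profile_repr m n)
        (\big[dadd_grepr/grepr0]_(i < ((m ^ n)`! %/ (m`! ^ n * n`!))%N)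
           \big[dadd_grepr/grepr0]_(l : multipart m n)
             muln_grepr (wreath_specht mu l) (rdegree (wreath_specht mu l)))].
Proof.
have := @regular_family _ [set: wreath m n]%G (multipart m n) (wreath_specht mu)
  (wreath_specht_degree mu).
case=> [w _ | irr inj onto decomp]; first exact: wreath_regular.
split=> //; apply: decomp => w _; exact: mxtrace_profile.
Qed.
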